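(* Let $X$ be a random vector in $\Omega_X\subset\mathbb{R}^p$ and $Y$ a random element of a separable metric space $(\mathcal{Y},d_{\mathcal{Y}})$, such that the family of conditional distributions $\{P_{X\mid Y}(\cdot\mid y)\}$ is dominated by a $\sigma$-finite measure, and let $\boldsymbol f_0:\mathbb{R}^p\to\mathbb{R}^d$ ($d<p$), with $E\{\boldsymbol f_0(X)\}=0$ and $\operatorname{Var}\{\boldsymbol f_0(X)\}=\mathbf I_d$, generate the central $\sigma$-field: $\sigma\{\boldsymbol f_0(X)\}=\mathcal{G}_{Y\mid X}$. Let $f_1^*,\dots,f_{d+1}^*$ and $l_1^*,\dots,l_{d+1}^*$ be as defined in the context, and assume the strict gap condition $$l_i^*=-\mathrm{FCCov}(f_i^*(X)\mid Y)<-\mathrm{FCCov}(f_j^*(X)\mid Y)=l_j^*\qquad\text{for all }1\le i<j\le d+1 .$$ Let $\boldsymbol f^*=(f_1^*,\dots,f_d^* )^\top$ and $L=\operatorname{diag}(l_1^*,\dots,l_d^* )$. Let $\lambda>0$ and let $\boldsymbol f_\lambda^*=(f_{1,\lambda}^*,\dots,f_{d,\lambda}^* )^\top$ be the minimizer over $\boldsymbol f=(f_1,\dots,f_d)^\top\in\{L_2(P_X)\}^d$ (with $E\boldsymbol f(X)=0$) of $$L_F(\lambda,\boldsymbol f)=-\sum_{t=1}^d\mathrm{FCCov}(f_t(X)\mid Y)+\lambda\,\|\operatorname{Var}\{\boldsymbol f(X)\}-\mathbf I_d\|_F^2 .$$ Then: (a) $\boldsymbol f_\lambda^*=V\left(\mathbf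 I_d-\frac{L}{2\lambda}\right)^{1/2}\boldsymbol f^*$ for some $d\times d$ orthogonal matrix $V$. (b) $f_{j,\lambda}^*\in\mathfrak{S}_{\sigma\{\boldsymbol f_0(X)\}}$ for all $1\le j\le d$.
   Context: $P_X$ is the distribution of $X$; $L_2(P_X)$ is the space of real functions square-integrable with respect to $P_X$; $\|\cdot\|_F$ is the Frobenius norm; $\mathbf I_m$ is the identity matrix. Functions are taken centered ($E f(X)=0$), which does not affect FCCov or variances. Central $\sigma$-field: $\mathcal{G}_{Y\mid X}$ is the unique minimal sub-$\sigma$-field of $\sigma(X)$ such that $Y$ and $X$ are conditionally independent given it (it exists and is unique under the domination assumption). $\mathfrak{S}_{\sigma\{\boldsymbol f_0(X)\}}$ is the class of $f\in L_2(P_X)$ such that $f(X)$ is $\sigma\{\boldsymbol f_0(X)\}$-measurable. Fréchet cumulative covariance: let $\bar Y,\tilde Y$ be independent copies of $Y$, independent of each other and of $(X,Y)$, and assume $E\,d_{\mathcal{Y}}^2(Y,\tilde Y)<\infty$. For $f\in L_2(P_X)$ put $$c_f(\bar Y,\tilde Y)=\operatorname{cov}\{f(X),I[d_{\mathcal{Y}}(Y,\tilde Y)<d_{\mathcal{Y}}(\bar Y,\tilde Y)]\mid\bar Y,\tilde Y\},\qquad \mathrm{FCCov}(f(X)\mid Y)=E[c_f(\bar Y,\tilde Y)^2].$$ Constrained problem: for a positive integer $m$, maximize $\sum_{t=1}^m\mathrm{FCCov}(f_t(X)\mid Y)$ over $f_1,\dots,f_m\in L_2(P_X)$ subject to $\operatorname{Var}\{(f_1(X),\dots,f_m(X))^\top\}=\mathbf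 I_m$. Multiplying a solution by an orthogonal matrix gives another solution, so the solution $(f_1^*,\dots,f_m^* )^\top$ is normalized to satisfy $$-E\left[c_{f_i^*}(\bar Y,\tilde Y)\,c_{f_j^*}(\bar Y,\tilde Y)\right]=l_i^*\,I(i=j),\qquad l_1^*\le l_2^*\le\cdots\le l_m^* .$$ The functions $f_1^*,\dots,f_{d+1}^*$ and numbers $l_1^*,\dots,l_{d+1}^*$ are those of such a normalized (centered) solution with $m=d+1$; its first $d$ components $\boldsymbol f^*$ serve as the solution for $m=d$. *)

(* Defs.v *)
From HB Require Import structures.
From mathcomp Require Import all_boot all_order all_algebra.
From mathcomp Require Import all_classical all_reals all_analysis.

Set Implicit Arguments.
Unset Strict Implicit.
Unset Printing Implicit Defensive.

Import Order.TTheory GRing.Theory Num.Theory.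
Import numFieldNormedType.Exports.

Local Open Scope classical_set_scope.
Local Open Scope ring_scope.

(* [metricType] allows the empty space whereas [measurableType] requires a
   point; a space carrying a random element is nonempty anyway. *)
#[short(type="pmetricType")]
HB.structure Definition PointedMetric (R : numDomainType) :=
  { M of Metric R M & isPointed M }.

Definition borelType (R : realType) (M : pmetricType R) :=
  g_sigma_algebraType (@open M).

Definition separable_space (T : topologicalType) : Prop :=
  exists2 D : set T, countable D & dense D.

Section conditioning.
Context d (T : measurableType d) (R : realType) (P : probability T R).
Implicit Types (G : set (set T)) (U V : T -> R).

Definition wrt_sigma_field G V : Prop :=
  forall B : set R, measurable B -> G (V @^-1` B).

Definition cond_exp_version G U V : Prop :=
  [/\ wrt_sigma_field G V,
      P.-integrable [set: T] (EFin \o V) &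
      forall A, G A ->
        (\int[P]_(w in A) (V w)%:E = \int[P]_(w in A) (U w)%:E)%E].

(* A chosen version of E[U | G]; it is unique only up to P-null sets, and the
   value is a dummy when there is no version (e.g. U not integrable). *)
Definition cond_exp G U : T -> R :=
  xget (cst 0 : T -> R) [set V | cond_exp_version G U V].

Definition cond_prob G (A : set T) : T -> R := cond_exp G (\1_A : T -> R).

Definition cond_cov G U V : T -> R :=
  cond_exp G ((U - cond_exp G U) * (V - cond_exp G V)).

Definition sub_sigma_field G H : Prop :=
  sigma_algebra [set: T] G /\ G `<=` H.

Context d1 d2 (T1 : measurableType d1) (T2 : measurableType d2).
Implicit Types (X : {RV P >-> T1}) (Y : {RV P >-> T2}).

Definition cond_indep G X Y : Prop :=
  forall (A : set T1) (B : set T2), measurable A -> measurable B ->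
    \forall w \ae P,
      cond_prob G (X @^-1` A `&` Y @^-1` B) w =
      cond_prob G (X @^-1` A) w * cond_prob G (Y @^-1` B) w.

(* As usual for sufficient sigma-fields, minimality is modulo P-null sets:
   with literal inclusion, minimal sigma-fields need not exist even under
   domination (glue two points of null probability in all possible ways). *)
Definition central_sigma_field X Y G : Prop :=
  [/\ sub_sigma_field G (g_sigma_algebra_preimage X),
      cond_indep G X Y &
      forall H, sub_sigma_field H (g_sigma_algebra_preimage X) ->
        cond_indep H X Y ->
        forall A, G A ->
          exists2 B, H B & P ((A `\` B) `|` (B `\` A)) = 0%E].

Definition cond_distribution X Y (kappa : R.-pker T2 ~> T1) : Prop :=
  forall (A : set T1) (B : set T2), measurable A -> measurable B ->
    (P (X @^-1` A `&` Y @^-1` B) =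
     \int[distribution P Y]_(y in B) kappa y A)%E.

Definition dominated_cond_distribution X Y : Prop :=
  exists (kappa : R.-pker T2 ~> T1)
         (nu : {sigma_finite_measure set T1 -> \bar R}),
    cond_distribution X Y kappa /\ forall y, kappa y `<< nu.

Definition independent_copies X Y (Ybar Ytil : {RV P >-> T2}) : Prop :=
  [/\ forall B : set T2, measurable B ->
        distribution P Ybar B = distribution P Y B,
      forall B : set T2, measurable B ->
        distribution P Ytil B = distribution P Y B &
      forall (A : set (T1 * T2)) (B C : set T2),
        measurable A -> measurable B -> measurable C ->
        P ((fun w => (X w, Y w)) @^-1` A `&` Ybar @^-1` B `&` Ytil @^-1` C) =
        (P ((fun w => (X w, Y w)) @^-1` A) *
         P (Ybar @^-1` B) * P (Ytil @^-1` C))%E].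

(* Centering f changes neither FCCov nor variances. *)
Definition L2c X (f : T1 -> R) : Prop :=
  f \in Lfun (distribution P X) 2%:E /\ 'E_P[f \o X]%E = 0%E.

(* Membership in L_2(P_X) is up to P_X-null sets, hence the representative g. *)
Definition L2_measurable_wrt X G (f : T1 -> R) : Prop :=
  f \in Lfun (distribution P X) 2%:E /\
  exists g : T1 -> R,
    [/\ g \in Lfun (distribution P X) 2%:E,
        \forall x \ae distribution P X, f x = g x &
        wrt_sigma_field G (g \o X)].

Definition var_mx X m (f : 'I_m -> T1 -> R) : 'M[R]_m :=
  \matrix_(i, j) fine (covariance P (f i \o X) (f j \o X)).

End conditioning.

Section frechet_cumulative_covariance.
Context d (T : measurableType d) (R : realType) (P : probability T R).
Context d1 (T1 : measurableType d1) (M : pmetricType R).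
Variables (X : {RV P >-> T1}) (Y Ybar Ytil : {RV P >-> borelType M}).

Definition dist_lt : set T :=
  [set w | mdist (Y w : M) (Ytil w) < mdist (Ybar w : M) (Ytil w)].

Definition c_fun (f : T1 -> R) : T -> R :=
  cond_cov P (g_sigma_algebra_preimage (fun w => (Ybar w, Ytil w)))
    (f \o X) (\1_dist_lt).

Definition FCCov (f : T1 -> R) : R := fine 'E_P[(c_fun f ^+ 2)%R]%E.

Definition FCCov2 (f g : T1 -> R) : R := fine 'E_P[(c_fun f * c_fun g)%R]%E.

Definition constrained_solution m (f : 'I_m -> T1 -> R) : Prop :=
  [/\ forall i, L2c X (f i), var_mx X f = 1%:M &
      forall g : 'I_m -> T1 -> R, (forall i, L2c X (g i)) ->
        var_mx X g = 1%:M ->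
        \sum_(t < m) FCCov (g t) <= \sum_(t < m) FCCov (f t)].

Definition normalized_solution m (f : 'I_m -> T1 -> R) (l : 'I_m -> R) :
    Prop :=
  [/\ constrained_solution f,
      forall i j, - FCCov2 (f i) (f j) = if i == j then l i else 0 &
      forall i j : 'I_m, (i <= j)%N -> l i <= l j].

Definition frobenius_norm m n (A : 'M[R]_(m, n)) : R :=
  Num.sqrt (\sum_i \sum_j A i j ^+ 2).

Definition penalized_loss m (lambda : R) (f : 'I_m -> T1 -> R) : R :=
  - \sum_(t < m) FCCov (f t) + lambda * frobenius_norm (var_mx X f - 1%:M) ^+ 2.

Definition penalized_minimizer m (lambda : R) (f : 'I_m -> T1 -> R) : Prop :=
  (forall i, L2c X (f i)) /\
  forall g : 'I_m -> T1 -> R, (forall i, L2c X (g i)) ->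
    penalized_loss lambda f <= penalized_loss lambda g.

End frechet_cumulative_covariance.

(* S = A^{1/2}, the positive semidefinite square root. *)
Definition psd_sqrt_mx (R : realType) n (A S : 'M[R]_n) : Prop :=
  [/\ S^T = S, forall v : 'cV[R]_n, 0 <= (v^T *m S *m v) 0 0 & S *m S = A].

Definition orthogonal_mx (R : realType) n (V : 'M[R]_n) : Prop :=
  V *m V^T = 1%:M.

(* Main.v *)
Require Import Defs.
From HB Require Import structures.
From mathcomp Require Import all_boot all_order all_algebra.
From mathcomp Require Import all_classical all_reals all_analysis.
From mathcomp Require Import measurable_realfun.
From mathcomp Require Import ring lra.

(* Both the covariance and the form (f, g) |-> E[c_f c_g] are psd bilinear forms
   on the centered L2 functions. A Ky Fan perturbation argument shows that the
   f_i* are eigenfunctions of the second form relative to the first, with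
   eigenvalues -l_i*, and that the last eigenvalue bounds its Rayleigh quotient
   on the orthogonal complement of the others.

   (a) Let W be the matrix of coordinates <f_lambda_t, f_i*> and N the Gram matrix
   of f_lambda minus the identity. The Euler-Lagrange equations of the penalized
   problem give N w_i = -l_i*/(2 lambda) w_i for the columns w_i of W, which are
   therefore orthogonal. None of them vanishes, for otherwise the second-order
   condition in the direction f_i* would contradict the Rayleigh bound. So W is
   invertible, and the gap forces the part of f_lambda outside the span of the
   f_i* to be null; hence |w_i|^2 = 1 - l_i*/(2 lambda).

   (b) If h(X) has zero conditional expectation given f_0(X), conditional
   independence makes h(X) uncorrelated with every event in Y, so c_h = 0. By the
   eigenvalue equation f_i* is then orthogonal to all such h, i.e. it equals its
   own conditional expectation given f_0(X). *)

Set Implicit Arguments.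
Unset Strict Implicit.
Unset Printing Implicit Defensive.

Import Order.TTheory GRing.Theory Num.Theory.
Import numFieldNormedType.Exports.

Local Open Scope classical_set_scope.
Local Open Scope ring_scope.

(** * Positive semidefinite forms *)

(** Only optimality is used: along any admissible variation the comparison with the optimum is a
    polynomial inequality of degree at most four in a real parameter, so the first and second order
    conditions are sign conditions on coefficients. Vectors are actual functions, not classes, so
    both forms are merely semidefinite; equality of functions is obtained as nullity of a difference
    for the covariance and becomes almost sure equality only at the end. The extra function, the
    (d+1)-st, supplies a level that is nonnegative and strictly below the first d eigenvalues. It
    therefore makes those positive, and it separates the first d functions from everything
    orthogonal to them. On the probabilistic side, c_f is a nonlinear-looking conditional covariance
    built from chosen versions. Independence of the copies together with centering reduces it to
    E[1_D f(X) | Ybar, Ytil], with D the event [dist_lt]; this is linear in f up to null sets and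
    bounded by E|f(X)|. Conditional expectations are compared through integrals over events and are
    written as k(Z), with k bounded whenever products have to stay integrable. *)

Section quartic.
Variable R : realFieldType.

Lemma quartic_ge0_linear_coef (a b c e : R) :
  (forall x, 0 <= x * a + x ^+ 2 * b + x ^+ 3 * c + x ^+ 4 * e) -> a = 0.
Proof.
move=> H; apply/eqP/negP => /negP a0.
pose K := `|b| + `|c| + `|e| + `|a|.
have na : 0 < `|a| by rewrite normr_gt0.
have K0 : 0 < K by rewrite ltr_wpDl// !addr_ge0.
pose x := - (a / (2 * K)).
have K0' : K != 0 by rewrite gt_eqF.
have xa : x * K = - a / 2.
  by rewrite /x; field.
have x1 : `|x| <= 1.
  rewrite /x normrN normrM normfV (gtr0_norm (_ : 0 < 2 * K)) ?mulr_gt0//.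
  rewrite ler_pdivrMr ?mulr_gt0// mul1r /K.
  have := normr_ge0 b; have := normr_ge0 c; have := normr_ge0 e; lra.
have x2 : x ^+ 2 <= 1 by rewrite -real_normK ?num_real// exprn_ile1.
have lb : x * c <= `|c|.
  apply: le_trans (ler_norm _) _; rewrite normrM; exact: ler_piMl.
have le : x ^+ 2 * e <= `|e|.
  apply: le_trans (ler_norm _) _; rewrite normrM normrX ler_piMl// exprn_ile1//.
have /(_ x) := H.
rewrite (_ : _ + _ = x * a + x ^+ 2 * (b + x * c + x ^+ 2 * e)); last by ring.
have : b + x * c + x ^+ 2 * e <= K.
  by have := ler_norm b; rewrite /K; lra.
move=> h1 h2.
have h3 : 0 <= x * a + x ^+ 2 * K.
  by apply: le_trans h2 _; rewrite lerD2l ler_wpM2l ?sqr_ge0.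
have : x * a + x ^+ 2 * K = - (a ^+ 2 / (4 * K)).
  by rewrite /x; field.
move=> e1; rewrite e1 in h3.
have : 0 < a ^+ 2 / (4 * K).
  by apply: divr_gt0; [rewrite exprn_even_gt0//=; apply/negP|rewrite mulr_gt0].
lra.
Qed.

Lemma quartic_ge0_quadratic_coef (b e : R) :
  (forall x, 0 <= x ^+ 2 * b + x ^+ 4 * e) -> 0 <= b.
Proof.
move=> H; rewrite leNgt; apply/negP => b0.
pose K := `|e| + `|b|.
have nb : 0 < `|b| by rewrite normr_gt0 lt_eqF.
have K0 : 0 < K by rewrite ltr_wpDl.
(* Chosen so that y^2 e <= y K = -b/2, which leaves b + y^2 e <= b/2 < 0. *)
pose y := - b / (2 * K).
have y0 : 0 < y by rewrite divr_gt0 ?mulr_gt0// oppr_gt0.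
have yK : y * K = - b / 2 by rewrite /y; field; rewrite gt_eqF.
have y1 : y <= 1.
  rewrite /y ler_pdivrMr ?mulr_gt0// mul1r /K.
  have := ler_norm (- b); rewrite normrN; have := normr_ge0 e; lra.
have yy : y ^+ 2 <= y by rewrite expr2 ler_piMl// ltW.
have /(_ y) := H.
rewrite (_ : _ + _ = y ^+ 2 * (b + y ^+ 2 * e)); last by ring.
rewrite pmulr_rge0 ?exprn_gt0// => h.
have : y ^+ 2 * e <= y * K.
  apply: (@le_trans _ _ (y ^+ 2 * K)).
    by rewrite ler_wpM2l ?sqr_ge0// /K; have := ler_norm e; lra.
  by rewrite ler_wpM2r// ltW.
rewrite yK; lra.
Qed.
End quartic.

Section psd_forms.
Context (R : rcfType) (E : lmodType R) (D : E -> Prop).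

(** A predicate on an ambient space, because the centered L2 functions are used as a part of the
    space of all functions. *)
Definition lin_closed := D 0 /\ forall a u v, D u -> D v -> D (a *: u + v).

Definition psd_form (b : E -> E -> R) :=
  [/\ forall u v, D u -> D v -> b u v = b v u,
      forall a u v w, D u -> D v -> D w -> b (a *: u + v) w = a * b u w + b v w &
      forall u, D u -> 0 <= b u u].

Hypothesis DL : lin_closed.

Lemma lin_closedD u v : D u -> D v -> D (u + v).
Proof. by move=> Du Dv; rewrite -[u]scale1r; apply: DL.2. Qed.

Lemma lin_closedZ a u : D u -> D (a *: u).
Proof. by move=> Du; rewrite -[_ *: _]addr0; apply: DL.2 => //; case: DL. Qed.

Lemma lin_closedB u v : D u -> D v -> D (u - v).
Proof.
by move=> Du Dv; rewrite -scaleN1r; apply: lin_closedD => //; exact: lin_closedZ.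
Qed.

Lemma lin_closed_sum I (r : seq I) (c : I -> R) (v : I -> E) :
  (forall i, D (v i)) -> D (\sum_(i <- r) c i *: v i).
Proof.
move=> Dv; elim/big_ind: _ => [|x y|i _]; first by case: DL.
  exact: lin_closedD.
exact: lin_closedZ.
Qed.

Section one_form.
Variable b : E -> E -> R.
Hypothesis bP : psd_form b.

Lemma formC u v : D u -> D v -> b u v = b v u. Proof. by case: bP => + _ _; exact. Qed.

Lemma formDl u v w : D u -> D v -> D w -> b (u + v) w = b u w + b v w.
Proof. by case: bP => _ + _ *; rewrite -{1}[u]scale1r => ->//; rewrite mul1r. Qed.

Lemma form0l w : D w -> b 0 w = 0.
Proof.
move=> Dw; have D0 : D 0 by case: DL.
have := formDl D0 D0 Dw; rewrite addr0 => /esym/eqP.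
by rewrite -subr_eq0 addrK => /eqP.
Qed.

Lemma formZl a u w : D u -> D w -> b (a *: u) w = a * b u w.
Proof.
move=> Du Dw; case: bP => _ + _; have D0 : D 0 by case: DL.
by move=> /(_ a u 0 w Du D0 Dw); rewrite addr0 form0l// addr0.
Qed.

Lemma formBl u v w : D u -> D v -> D w -> b (u - v) w = b u w - b v w.
Proof.
move=> Du Dv Dw; rewrite formDl//; last by rewrite -scaleN1r; exact: lin_closedZ.
by rewrite -scaleN1r formZl// mulN1r.
Qed.

Lemma formDr u v w : D u -> D v -> D w -> b w (u + v) = b w u + b w v.
Proof.
by move=> *; rewrite formC// ?formDl// ?(formC (u := w))//; exact: lin_closedD.
Qed.

Lemma formZr a u w : D u -> D w -> b w (a *: u) = a * b w u.
Proof. by move=> *; rewrite formC// ?formZl// ?(formC (u := w))//; exact: lin_closedZ. Qed.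

Lemma formBr u v w : D u -> D v -> D w -> b w (u - v) = b w u - b w v.
Proof.
by move=> *; rewrite formC// ?formBl// ?(formC (u := w))//; exact: lin_closedB.
Qed.

Lemma form_suml I (r : seq I) (c : I -> R) (v : I -> E) w :
  (forall i, D (v i)) -> D w ->
  b (\sum_(i <- r) c i *: v i) w = \sum_(i <- r) c i * b (v i) w.
Proof.
move=> Dv Dw; elim: r => [|i r IH]; first by rewrite !big_nil form0l.
rewrite !big_cons formDl ?IH ?formZl//; first exact: lin_closedZ.
exact: lin_closed_sum.
Qed.

Lemma form_sumr I (r : seq I) (c : I -> R) (v : I -> E) w :
  (forall i, D (v i)) -> D w ->
  b w (\sum_(i <- r) c i *: v i) = \sum_(i <- r) c i * b w (v i).
Proof.
move=> Dv Dw; rewrite formC// ?form_suml//; last exact: lin_closed_sum.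
by apply: eq_bigr => i _; rewrite (formC (u := w)).
Qed.

Lemma form_line (t : R) u h : D u -> D h ->
  b (u + t *: h) (u + t *: h) = b u u + t * (2 * b u h) + t ^+ 2 * b h h.
Proof.
move=> Du Dh; have Dth := lin_closedZ t Dh; have Dut := lin_closedD Du Dth.
rewrite formDl// !formZl// !formDr// !formZr// (formC (u := h) (v := u))//.
ring.
Qed.

End one_form.
End psd_forms.

(** * Orthonormal frames that maximize the trace of a form *)

Section ky_fan.
Context (R : rcfType) (E : lmodType R) (D : E -> Prop).
Hypothesis DL : lin_closed D.
Variables ip b : E -> E -> R.
Hypotheses (ipP : psd_form D ip) (bP : psd_form D b).

Definition orthonormal_family n (f : 'I_n -> E) :=
  forall i j, ip (f i) (f j) = (i == j)%:R.

Variables (n : nat) (f : 'I_n -> E).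
Hypotheses (Df : forall i, D (f i)) (f1 : orthonormal_family f).
Hypothesis fmax : forall g : 'I_n -> E, (forall i, D (g i)) -> orthonormal_family g ->
  \sum_i b (g i) (g i) <= \sum_i b (f i) (f i).

(** Tilt [f i] to [f i + t *: h], renormalize by the square root of q = 1 + t^2 |h|^2 and keep the
    other members: the frame stays orthonormal. Maximality, multiplied by q, is a quadratic
    inequality in t; its coefficients of t and t^2 give the two claims. *)
Lemma maximal_frame_perturb i h : D h -> (forall j, ip (f j) h = 0) ->
  b (f i) h = 0 /\ b h h <= b (f i) (f i) * ip h h.
Proof.
move=> Dh fh.
have nh : 0 <= ip h h by case: ipP => _ _; exact.
have key t : 0 <= t * (- (2 * b (f i) h)) +
    t ^+ 2 * (b (f i) (f i) * ip h h - b h h).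
  pose q := 1 + t ^+ 2 * ip h h.
  have q0 : 0 < q by rewrite ltr_wpDr// mulr_ge0// sqr_ge0.
  pose s := (Num.sqrt q)^-1.
  have s2 : s * s = q^-1 by rewrite -invfM -expr2 sqr_sqrtr// ltW.
  pose k := f i + t *: h.
  have Dth : D (t *: h) by exact: lin_closedZ.
  have Dk : D k by exact: lin_closedD.
  pose g j := if j == i then s *: k else f j.
  have Dg j : D (g j) by rewrite /g; case: ifP => // _; exact: lin_closedZ.
  have kk : ip k k = q by rewrite (form_line DL ipP)// fh f1 eqxx mulr1n /q; ring.
  have kf j : j != i -> ip k (f j) = 0.
    move=> ji; rewrite (formDl ipP)// (formZl DL ipP)// f1.
    by rewrite eq_sym (negbTE ji) (formC ipP)// fh mulr0 addr0.
  have og : orthonormal_family g.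
    move=> j1 j2; rewrite /g.
    case: (eqVneq j1 i) => [e1|n1]; case: (eqVneq j2 i) => [e2|n2].
    - rewrite (formZl DL ipP) ?(formZr DL ipP)//; last exact: lin_closedZ.
      by rewrite mulrA kk s2 (mulVf (lt0r_neq0 q0)) e1 e2 eqxx.
    - by rewrite (formZl DL ipP)// kf// mulr0 e1 eq_sym (negbTE n2).
    - by rewrite (formZr DL ipP)// (formC ipP)// kf// mulr0 e2 (negbTE n1).
    - exact: f1.
  have := fmax Dg og; rewrite (bigD1 i)//= [leRHS](bigD1 i)//=.
  rewrite [X in _ + X <= _](eq_bigr (fun j => b (f j) (f j))); last first.
    by move=> j /negbTE ji; rewrite /g ji.
  rewrite lerD2r /g eqxx (formZl DL bP) ?(formZr DL bP)//; last exact: lin_closedZ.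
  rewrite mulrA s2 mulrC ler_pdivrMr// (form_line DL bP)// /q; lra.
have b0 : - (2 * b (f i) h) = 0.
  apply: (@quartic_ge0_linear_coef _ _ (b (f i) (f i) * ip h h - b h h) 0 0) => x.
  by rewrite !mulr0 !addr0.
split; first by lra.
rewrite -subr_ge0; apply: (@quartic_ge0_quadratic_coef _ _ 0) => x.
by rewrite mulr0 addr0; have := key x; rewrite b0 mulr0 add0r.
Qed.

Hypothesis fdiag : forall i j, i != j -> b (f i) (f j) = 0.

Lemma orthonormal_residual h : D h -> exists2 g, D g &
  [/\ h = \sum_i ip (f i) h *: f i + g & forall j, ip (f j) g = 0].
Proof.
move=> Dh; pose p := \sum_i ip (f i) h *: f i.
have Dp : D p by exact: lin_closed_sum.
exists (h - p); first exact: lin_closedB.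
split=> [|j]; first by rewrite addrC subrK.
rewrite (formBr DL ipP)// (form_sumr DL ipP)// (bigD1 j)//= big1 => [|i ij].
  by rewrite f1 eqxx mulr1 addr0 subrr.
by rewrite f1 eq_sym (negbTE ij) mulr0.
Qed.

(** Maximality handles the part of [h] orthogonal to the frame. Inside the span it only fixes the
    trace, so there the diagonal normalization [fdiag] takes over. *)
Lemma maximal_frame_eigen i h : D h -> b (f i) h = b (f i) (f i) * ip (f i) h.
Proof.
move=> Dh; have [g Dg [-> fg]] := orthonormal_residual Dh.
have Ds : D (\sum_j ip (f j) h *: f j) by exact: lin_closed_sum.
rewrite (formDr DL bP)// (form_sumr DL bP)// (formDr DL ipP)// fg addr0.
rewrite (maximal_frame_perturb i Dg fg).1 addr0 (form_sumr DL ipP)//.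
rewrite (bigD1 i)//= [in RHS](bigD1 i)//= !big1; first by rewrite f1 eqxx mulr1n; ring.
  by move=> j ji; rewrite f1 eq_sym (negbTE ji) mulr0.
by move=> j ji; rewrite fdiag ?mulr0// eq_sym.
Qed.

(** Here [h] is a multiple of [f k] plus a part [g] orthogonal to the frame. The cross terms vanish
    for both forms, and [g] obeys the second-order bound for the index [k]. *)
Lemma maximal_frame_rayleigh k h : D h -> (forall j, j != k -> ip (f j) h = 0) ->
  b h h <= b (f k) (f k) * ip h h.
Proof.
move=> Dh fh; have [g Dg [hE fg]] := orthonormal_residual Dh.
have {}hE : h = g + ip (f k) h *: f k.
  rewrite {1}hE (bigD1 k)//= big1 ?addr0; first by rewrite addrC.
  by move=> j jk; rewrite fh// scale0r.
have [bg bgg] := maximal_frame_perturb k Dg fg.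
rewrite hE (form_line DL bP)// (form_line DL ipP)//.
rewrite (formC bP Dg)// (formC ipP Dg)// fg bg f1 eqxx.
by rewrite !mulr0 !addr0 mulr1 mulrDr lerD// mulrC.
Qed.

End ky_fan.

(** * First and second variation of the penalized loss *)

Section penalized.
Context (R : rcfType) (E : lmodType R) (D : E -> Prop).
Hypothesis DL : lin_closed D.
Variables ip b : E -> E -> R.
Hypotheses (ipP : psd_form D ip) (bP : psd_form D b).
Variables (lambda : R) (d : nat).

Definition gram_excess (u : 'I_d -> E) : 'M[R]_d :=
  \matrix_(i, j) (ip (u i) (u j) - (i == j)%:R).

Definition form_loss (u : 'I_d -> E) : R :=
  - \sum_t b (u t) (u t) + lambda * \sum_i \sum_j gram_excess u i j ^+ 2.

Variables (u : 'I_d -> E).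
Hypotheses (Du : forall t, D (u t)).
Hypothesis umin : forall w : 'I_d -> E, (forall t, D (w t)) ->
  form_loss u <= form_loss w.
Let N := gram_excess u.

Lemma gram_excessC t s : N t s = N s t.
Proof. by rewrite !mxE (formC ipP)// eq_sym. Qed.

(** All components move along one [h], with weights [v]. A unit vector [v] yields the Euler-Lagrange
    equations; the second-order condition needs arbitrary weights. The Gram matrix is quadratic in
    [x] and enters squared, hence the degree four. *)
Lemma form_loss_perturb (v : 'I_d -> R) h x : D h ->
  form_loss (fun t => u t + (x * v t) *: h) - form_loss u =
  x * (- \sum_t 2 * (v t * b (u t) h) + lambda * \sum_t \sum_s
         2 * (N t s * (v s * ip (u t) h + v t * ip (u s) h))) +
  x ^+ 2 * (- \sum_t (v t ^+ 2 * b h h) + lambda * \sum_t \sum_s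
         ((v s * ip (u t) h + v t * ip (u s) h) ^+ 2 +
           2 * (N t s * (v t * v s * ip h h)))) +
  x ^+ 3 * (lambda * \sum_t \sum_s
     (2 * ((v s * ip (u t) h + v t * ip (u s) h) * (v t * v s * ip h h)))) +
  x ^+ 4 * (lambda * \sum_t \sum_s (v t * v s * ip h h) ^+ 2).
Proof.
move=> Dh; rewrite /form_loss.
under eq_bigr do rewrite (form_line DL bP)//.
rewrite [X in _ + lambda * X - _](_ : _ = \sum_t \sum_s (N t s ^+ 2 +
    (x * (2 * (N t s * (v s * ip (u t) h + v t * ip (u s) h))) +
    (x ^+ 2 * ((v s * ip (u t) h + v t * ip (u s) h) ^+ 2 +
           2 * (N t s * (v t * v s * ip h h))) +
    (x ^+ 3 * (2 * ((v s * ip (u t) h + v t * ip (u s) h) * (v t * v s * ip h h)))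
     + x ^+ 4 * (v t * v s * ip h h) ^+ 2))))); last first.
  apply: eq_bigr => t _; apply: eq_bigr => s _; rewrite !mxE.
  have D1 y : D (y *: h) by exact: lin_closedZ.
  rewrite (formDl ipP)//; last exact: lin_closedD.
  rewrite !(formDr DL ipP)// !(formZl DL ipP)// !(formZr DL ipP)//.
  rewrite (formC ipP Dh (Du s)); ring.
have sumD (F G : 'I_d -> 'I_d -> R) : \sum_t \sum_s (F t s + G t s) =
    \sum_t \sum_s F t s + \sum_t \sum_s G t s.
  by rewrite -big_split; apply: eq_bigr => t _; rewrite big_split.
have sumZ a (F : 'I_d -> 'I_d -> R) : \sum_t \sum_s (a * F t s) =
    a * \sum_t \sum_s F t s.
  by rewrite mulr_sumr; apply: eq_bigr => t _; rewrite mulr_sumr.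
rewrite sumD (sumD (fun t s => x * _)) (sumD (fun t s => x ^+ 2 * _)).
rewrite (sumD (fun t s => x ^+ 3 * _)).
rewrite !(sumZ (x ^+ _)) (sumZ x) !big_split/=.
rewrite [\sum_t (x * v t) * _](_ : _ = x * \sum_t 2 * (v t * b (u t) h)); last first.
  by rewrite mulr_sumr; apply: eq_bigr => t _; ring.
rewrite [\sum_t (x * v t) ^+ 2 * _](_ : _ = x ^+ 2 * \sum_t (v t ^+ 2 * b h h)); last first.
  by rewrite mulr_sumr; apply: eq_bigr => t _; ring.
rewrite -/N; ring.
Qed.

Lemma penalized_euler_lagrange h t : D h ->
  b (u t) h = 2 * lambda * \sum_s N t s * ip (u s) h.
Proof.
move=> Dh; pose v s : R := (s == t)%:R.
have H : - \sum_t 2 * (v t * b (u t) h) +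
    lambda * \sum_t \sum_s 2 * (N t s * (v s * ip (u t) h + v t * ip (u s) h)) = 0.
  have P x : 0 <= form_loss (fun s => u s + (x * v s) *: h) - form_loss u.
    rewrite subr_ge0; apply: umin => s.
    by apply: lin_closedD => //; exact: lin_closedZ.
  exact: (quartic_ge0_linear_coef (fun x => etrans
    (esym (congr1 (fun y => 0 <= y) (form_loss_perturb v x Dh))) (P x))).
move: H; rewrite (bigD1 t)//= big1 ?addr0; last first.
  by move=> s st; rewrite /v (negbTE st) mul0r mulr0.
(* The unit weights select row [t] in one double sum and column [t] in the other; symmetry of [N]
   merges them, hence the factor 4. *)
have -> : \sum_s1 \sum_s2 2 * (N s1 s2 * (v s2 * ip (u s1) h + v s1 * ip (u s2) h))
    = 4 * \sum_s N t s * ip (u s) h.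
  transitivity (2 * (\sum_s1 \sum_s2 v s2 * (N s1 s2 * ip (u s1) h) +
      \sum_s1 \sum_s2 v s1 * (N s1 s2 * ip (u s2) h))).
    rewrite -big_split/= mulr_sumr; apply: eq_bigr => s1 _.
    rewrite -big_split/= mulr_sumr; apply: eq_bigr => s2 _; ring.
  rewrite exchange_big/=.
  have dl (F : 'I_d -> 'I_d -> R) : \sum_s1 \sum_s2 v s1 * F s1 s2 = \sum_s F t s.
    rewrite (bigD1 t)//= [X in _ + X]big1 ?addr0; last first.
      by move=> s st; rewrite big1// => s' _; rewrite /v (negbTE st) mul0r.
    by apply: eq_bigr => s _; rewrite /v eqxx mul1r.
  rewrite !dl; under [X in X + _]eq_bigr do rewrite gram_excessC.
  by ring.
rewrite /v eqxx mul1r => H; lra.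
Qed.

(** For [h] orthogonal to every [u t] the Euler-Lagrange equations give [b (u t) h = 0], so the odd
    coefficients of the quartic vanish and the quadratic one must be nonnegative. The result bounds
    [N] below, as a quadratic form, by b(h, h)/(2 lambda). *)
Lemma penalized_second_order h (v : 'I_d -> R) : D h ->
  (forall t, ip (u t) h = 0) -> ip h h = 1 ->
  b h h * \sum_t v t ^+ 2 <= 2 * lambda * \sum_t \sum_s v t * N t s * v s.
Proof.
move=> Dh uh h1; rewrite -subr_ge0.
apply: (@quartic_ge0_quadratic_coef _ _
  (lambda * \sum_t \sum_s (v t * v s * ip h h) ^+ 2)) => x.
have := form_loss_perturb v x Dh.
have buh t : b (u t) h = 0.
  by rewrite penalized_euler_lagrange// big1 ?mulr0// => s _; rewrite uh mulr0.
rewrite [\sum_t 2 * (v t * b (u t) h)]big1; last by move=> t _; rewrite buh !mulr0.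
rewrite [X in x * (_ + lambda * X)]big1; last first.
  by move=> t _; rewrite big1// => s _; rewrite !uh; ring.
rewrite [X in x ^+ 3 * (lambda * X)]big1; last first.
  by move=> t _; rewrite big1// => s _; rewrite !uh; ring.
rewrite [X in x ^+ 2 * (_ + lambda * X)](_ : _ = 2 * \sum_t \sum_s v t * N t s * v s); last first.
  rewrite mulr_sumr; apply: eq_bigr => t _.
  rewrite mulr_sumr; apply: eq_bigr => s _; rewrite !uh h1; ring.
rewrite -mulr_suml => E1.
have : 0 <= form_loss (fun t : 'I_d => u t + (x * v t) *: h) - form_loss u.
  rewrite subr_ge0; apply: umin => t; apply: lin_closedD => //; exact: lin_closedZ.
rewrite E1; lra.
Qed.

End penalized.

(** The degenerate case of Cauchy-Schwarz: the form at [u + x *: h] is 2 x b(u, h) + x^2 b(h, h),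
    nonnegative for all x, so its linear coefficient is zero. *)
Lemma form_null (R : rcfType) (E : lmodType R) (D : E -> Prop)
    (b : E -> E -> R) u h : lin_closed D -> psd_form D b ->
  D u -> D h -> b u u = 0 -> b u h = 0.
Proof.
move=> DL bP Du Dh u0; have : 2 * b u h = 0; last by lra.
apply: (@quartic_ge0_linear_coef _ _ (b h h) 0 0) => x; rewrite !mulr0 !addr0.
have := form_line DL bP x Du Dh; rewrite u0 add0r => <-.
case: bP => _ _; apply; apply: lin_closedD => //; exact: lin_closedZ.
Qed.

Lemma sum_cauchy_schwarz (R : realFieldType) n (v y : 'I_n -> R) :
  (\sum_i v i * y i) ^+ 2 <= (\sum_i v i ^+ 2) * \sum_i y i ^+ 2.
Proof.
set c := \sum_i v i * y i; set m := \sum_i v i ^+ 2; set q := \sum_i y i ^+ 2.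
have m0 : 0 <= m by apply: sumr_ge0 => i _; exact: sqr_ge0.
(* The vector m y - c v is m times the part of y orthogonal to v. Its squared length carries a spare
   factor m, so m = 0, which forces v = 0, is treated apart. *)
have : 0 <= \sum_i (m * y i - c * v i) ^+ 2.
  by apply: sumr_ge0 => i _; exact: sqr_ge0.
have -> : \sum_i (m * y i - c * v i) ^+ 2 = m * (m * q - c ^+ 2).
  rewrite (eq_bigr (fun i => m ^+ 2 * y i ^+ 2 +
    (- (2 * m * c) * (v i * y i) + c ^+ 2 * v i ^+ 2))); last by move=> i _; ring.
  by rewrite !big_split/= -!mulr_sumr -/q -/c -/m; ring.
have [m_eq0 _|mN0] := eqVneq m 0; last first.
  by rewrite pmulr_rge0 ?subr_ge0// lt_def mN0.
have v0 i : v i = 0.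
  apply/eqP; rewrite -sqrf_eq0; apply/eqP.
  move/eqP: m_eq0; rewrite psumr_eq0 => [/allP/(_ i)|j _]; last exact: sqr_ge0.
  by rewrite mem_index_enum => /(_ isT)/eqP.
by rewrite m_eq0 mul0r /c big1 ?expr0n// => i _; rewrite v0 mul0r.
Qed.

(** * A penalized minimizer in the coordinates of the maximal frame *)

Section structure.
Context (R : rcfType) (E : lmodType R) (D : E -> Prop).
Hypothesis DL : lin_closed D.
Variables ip b : E -> E -> R.
Hypotheses (ipP : psd_form D ip) (bP : psd_form D b).
Variables (lambda : R) (d : nat) (f : 'I_d.+1 -> E) (u : 'I_d -> E).
Hypotheses (lambda0 : 0 < lambda).
Hypotheses (Df : forall i, D (f i)) (f1 : orthonormal_family ip f).
Hypothesis fmax : forall g : 'I_d.+1 -> E, (forall i, D (g i)) ->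
  orthonormal_family ip g -> \sum_i b (g i) (g i) <= \sum_i b (f i) (f i).
Hypothesis fdiag : forall i j, i != j -> b (f i) (f j) = 0.
Hypothesis gap : forall i j : 'I_d.+1, (i < j)%N ->
  b (f j) (f j) < b (f i) (f i).
Hypotheses (Du : forall t, D (u t)).
Hypothesis umin : forall w : 'I_d -> E, (forall t, D (w t)) ->
  form_loss ip b lambda u <= form_loss ip b lambda w.

Let emb (i : 'I_d) : 'I_d.+1 := widen_ord (leqnSn d) i.
Let a (i : 'I_d.+1) : R := b (f i) (f i).
Let c (i : 'I_d) : R := a (emb i) / (2 * lambda).
Let N := gram_excess ip u.
Let W : 'M[R]_d := \matrix_(t, i) ip (u t) (f (emb i)).
Let Q := W^T *m W.

Let emb_inj i j : (emb i == emb j) = (i == j).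
Proof. by rewrite -!val_eqE. Qed.

Let a_max i : a ord_max < a (emb i).
Proof. by apply: gap; rewrite /= ltn_ord. Qed.

Let a_ge0 i : 0 <= a i.
Proof. by case: bP => _ _; apply. Qed.

Let c_inj i j : i != j -> c i != c j.
Proof.
move=> ij; have l0 : (2 * lambda)^-1 != 0 by rewrite invr_eq0 mulf_neq0 ?gt_eqF.
rewrite /c (inj_eq (mulIf l0)).
have [ltij|leji] := ltnP i j.
  by rewrite gt_eqF//; exact: gap.
rewrite lt_eqF//; apply: gap => /=; rewrite ltn_neqAle leji andbT.
by rewrite eq_sym val_eqE.
Qed.

Let ca i : 2 * lambda * c i = a (emb i).
Proof. by rewrite /c mulrC divfK// mulf_neq0 ?gt_eqF. Qed.

Let euler_lagrange := penalized_euler_lagrange DL ipP bP Du umin.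

(** The number [b (u t) (f (emb i))] is computed twice, by the Euler-Lagrange equation for [u t] and
    by the eigenvalue equation for [f (emb i)]. *)
Let excess_coord t i : \sum_s N t s * W s i = c i * W t i.
Proof.
have l0 : 2 * lambda != 0 by rewrite mulf_neq0 ?gt_eqF.
apply: (mulfI l0); rewrite mulrA ca.
under eq_bigr do rewrite [W _ _]mxE.
rewrite -euler_lagrange// (formC bP)// (maximal_frame_eigen DL ipP bP Df f1 fmax fdiag)//.
by rewrite mxE (formC ipP).
Qed.

Let QE i j : Q i j = \sum_t W t i * W t j.
Proof. by rewrite mxE; apply: eq_bigr => t _; rewrite mxE. Qed.

Let Q_diag i j : i != j -> Q i j = 0.
Proof.
move=> ij; suff : (c i - c j) * Q i j = 0.
  by move/eqP; rewrite mulf_eq0 subr_eq0 (negbTE (c_inj ij)) => /eqP.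
rewrite mulrBl !QE; apply/eqP; rewrite subr_eq0; apply/eqP.
transitivity (\sum_t \sum_s W t j * N t s * W s i).
  rewrite mulr_sumr; apply: eq_bigr => t _.
  rewrite mulrA -excess_coord mulr_suml; apply: eq_bigr => s _; ring.
rewrite exchange_big/= mulr_sumr; apply: eq_bigr => t _.
rewrite mulrCA -excess_coord mulr_sumr; apply: eq_bigr => s _.
rewrite (gram_excessC ipP Du s t) -/N; ring.
Qed.

(* If column [i0] vanished, [N - c i0] would be psd by the second-order condition,
   which contradicts the Rayleigh bound on a nonzero [v] with [v *m W = 0]. *)
Let coord_neq0 i0 : ~ (forall t, W t i0 = 0).
Proof.
move=> W0.
(* [W] is square, so a zero column also provides a nonzero row vector [v] that annihilates [W]; the
   combination [z] of the [u t] with weights [v] is then orthogonal to the first d functions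
   [f (emb i)]. *)
have /det0P[v vN0 vW] : \det W == 0.
  rewrite -det_tr; apply/det0P; exists (delta_mx 0 i0).
    by apply/negP => /eqP/matrixP/(_ 0 i0); rewrite !mxE !eqxx => /eqP; rewrite oner_eq0.
  by rewrite -rowE; apply/rowP => t; rewrite !mxE -[RHS](W0 t) mxE.
(* With y = N v, the scalars are m = |v|^2, n = v.Nv and q = |Nv|^2. Both forms at [z] are expressed
   through them: ip(z, z) = n + m and b(z, z) = 2 lambda (q + n). *)
pose y s := \sum_r N s r * v 0 r.
pose m := \sum_t v 0 t ^+ 2; pose n := \sum_t v 0 t * y t; pose q := \sum_t y t ^+ 2.
have m0 : 0 < m.
  rewrite lt_def sumr_ge0 ?andbT; last by move=> i _; exact: sqr_ge0.
  apply: contra vN0; rewrite psumr_eq0 => [/allP H|j _]; last exact: sqr_ge0.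
  apply/eqP/rowP => t; rewrite mxE; apply/eqP; rewrite -sqrf_eq0.
  by apply: H; rewrite mem_index_enum.
have nq : n ^+ 2 <= m * q by exact: sum_cauchy_schwarz.
pose z := \sum_t v 0 t *: u t.
have Dz : D z by exact: lin_closed_sum.
have uz s : ip (u s) z = y s + v 0 s.
  rewrite (form_sumr DL ipP)// /y [X in _ = _ + X](_ : _ = \sum_r (s == r)%:R * v 0 r).
    by rewrite -big_split/=; apply: eq_bigr => r _; rewrite mxE; ring.
  rewrite (bigD1 s)//= eqxx mul1r big1 ?addr0// => r rs.
  by rewrite eq_sym (negbTE rs) mul0r.
have zz : ip z z = n + m.
  rewrite {1}/z (form_suml DL ipP)// -big_split/=; apply: eq_bigr => t _.
  by rewrite uz; ring.
have bzz : b z z = 2 * lambda * (q + n).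
  rewrite {1}/z (form_suml DL bP)//.
  under eq_bigr do rewrite euler_lagrange// mulrCA.
  rewrite -mulr_sumr; congr (_ * _).
  under eq_bigr do rewrite mulr_sumr.
  rewrite exchange_big/= -big_split/=; apply: eq_bigr => s _.
  rewrite uz (_ : y s ^+ 2 + _ = y s * (y s + v 0 s)); last by ring.
  rewrite /y mulr_suml; apply: eq_bigr => t _.
  by rewrite (gram_excessC ipP Du t s) -/N; ring.
have ray : b z z <= a ord_max * ip z z.
  apply: (maximal_frame_rayleigh DL ipP bP Df f1 fmax) => // j jmax.
  have jd : (j < d)%N.
    by rewrite ltn_neqAle -ltnS ltn_ord andbT; rewrite -val_eqE in jmax.
  move/rowP/(_ (Ordinal jd)): vW; rewrite !mxE => vW.
  rewrite (form_sumr DL ipP)// -[RHS]vW; apply: eq_bigr => t _.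
  rewrite mxE (formC ipP)//; congr (_ * ip _ (f _)); exact/val_inj.
have so : a (emb i0) * m <= 2 * lambda * n.
  have -> : n = \sum_t \sum_s v 0 t * N t s * v 0 s.
    by apply: eq_bigr => t _; rewrite mulr_sumr; apply: eq_bigr => s _; rewrite mulrA.
  apply: (penalized_second_order DL ipP bP Du umin) => //; last by rewrite f1 eqxx.
  by move=> t; have := W0 t; rewrite mxE.
have n0 : 0 <= n.
  rewrite -(@pmulr_rge0 _ (2 * lambda)) ?mulr_gt0//.
  by apply: le_trans so; rewrite mulr_ge0// ltW.
rewrite bzz zz in ray.
have l2 : 0 < 2 * lambda by rewrite mulr_gt0.
(* Multiply the Rayleigh bound by m, use n^2 <= m q and cancel n + m > 0: this gives 2 lambda n <=
   a_max m, whereas the second-order condition says 2 lambda n >= a_{i0} m > a_max m. *)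
have h1 : m * (2 * lambda * (q + n)) <= m * (a ord_max * (n + m)).
  by rewrite ler_pM2l.
have h2 : 2 * lambda * n ^+ 2 <= 2 * lambda * (m * q) by rewrite ler_pM2l.
have h3 : 2 * lambda * n * (n + m) <= a ord_max * m * (n + m) by lra.
have h4 : 2 * lambda * n <= a ord_max * m.
  by move: h3; rewrite ler_pM2r// ltr_wpDl.
have : a ord_max * m < a (emb i0) * m by rewrite ltr_pM2r.
lra.
Qed.

(** Since N W = W diag(c), each combination [z i] satisfies the eigenvalue equation for [a (emb i)].
    If u = V S f with V orthogonal and S diagonal, then W = V S and z_i = s_i^2 f_i with s_i^2 =
    Q_ii; [r i] is the deviation from this expected value. *)
Let z i := \sum_t W t i *: u t.
Let r i := z i - Q i i *: f (emb i).

Let Dz i : D (z i). Proof. exact: lin_closed_sum. Qed.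
Let Dr i : D (r i).
Proof. by apply: lin_closedB => //; exact: lin_closedZ. Qed.

Let Q_gt0 i : 0 < Q i i.
Proof.
have Q0 : 0 <= Q i i by rewrite QE sumr_ge0// => t _; rewrite -expr2 sqr_ge0.
rewrite lt_def Q0 andbT; apply/negP => /eqP; rewrite QE => /eqP.
rewrite psumr_eq0 => [/allP H|t _]; last by rewrite -expr2 sqr_ge0.
apply: (@coord_neq0 i) => t; apply/eqP; rewrite -sqrf_eq0 expr2.
by apply: H; rewrite mem_index_enum.
Qed.

Let residual_orth i j : ip (f (emb j)) (r i) = 0.
Proof.
have Dsf : D (Q i i *: f (emb i)) by exact: lin_closedZ.
rewrite (formBr DL ipP)// (form_sumr DL ipP)// (formZr DL ipP)// f1 emb_inj.
rewrite (_ : \sum_t _ = Q i j); last first.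
  by rewrite QE; apply: eq_bigr => t _; rewrite [W t j]mxE (formC ipP).
by have [->|ji] := eqVneq j i; rewrite ?mulr1 ?subrr// mulr0 subr0 Q_diag// eq_sym.
Qed.

Let z_eigen i h : D h -> b (z i) h = a (emb i) * ip (z i) h.
Proof.
move=> Dh; rewrite (form_suml DL bP)// (form_suml DL ipP)// -ca -mulrA.
under eq_bigr do rewrite euler_lagrange// mulrCA.
rewrite -mulr_sumr; congr (_ * _); rewrite mulr_sumr.
under eq_bigr do rewrite mulr_sumr.
rewrite exchange_big/=; apply: eq_bigr => s _; rewrite mulrA -excess_coord.
rewrite mulr_suml; apply: eq_bigr => t _.
by rewrite (gram_excessC ipP Du t s) -/N; ring.
Qed.

(** [r i] inherits the eigenvalue [a (emb i)], but it is orthogonal to the first d functions, where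
    the Rayleigh quotient is at most [a ord_max], which is strictly smaller. *)
Let residual_null i : ip (r i) (r i) = 0.
Proof.
have Dsf : D (Q i i *: f (emb i)) by exact: lin_closedZ.
have rr : b (r i) (r i) = a (emb i) * ip (r i) (r i).
  rewrite {1}/r (formBl DL bP)// z_eigen// (formZl DL bP)//.
  rewrite (maximal_frame_eigen DL ipP bP Df f1 fmax fdiag)// -/(a _).
  have -> : ip (r i) (r i) = ip (z i) (r i) - Q i i * ip (f (emb i)) (r i).
    by rewrite {1}/r (formBl DL ipP)// (formZl DL ipP).
  by ring.
have : b (r i) (r i) <= a ord_max * ip (r i) (r i).
  apply: (maximal_frame_rayleigh DL ipP bP Df f1 fmax) => // j jmax.
  have jd : (j < d)%N.
    by rewrite ltn_neqAle -ltnS ltn_ord andbT; rewrite -val_eqE in jmax.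
  by rewrite (_ : j = emb (Ordinal jd)) ?residual_orth//; exact/val_inj.
have r0 : 0 <= ip (r i) (r i) by case: ipP => _ _; apply.
rewrite rr -subr_le0 -mulrBl pmulr_rle0 ?subr_gt0// => rle0.
by apply/eqP; rewrite eq_le rle0.
Qed.

(** Two values of ip(z_i, z_i): the Gram matrix of [u] is 1 + N and acts on column i of [W] as 1 +
    c_i, giving Q_ii (1 + c_i); and z_i equals Q_ii f_i up to a null vector, giving Q_ii^2. *)
Let Q_eigenvalue i : Q i i = 1 + c i.
Proof.
have zz : ip (z i) (z i) = Q i i * (1 + c i).
  rewrite {1}/z (form_suml DL ipP)// QE mulr_suml; apply: eq_bigr => t _.
  rewrite -mulrA; congr (_ * _); rewrite (form_sumr DL ipP)// mulrDr mulr1.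
  rewrite [_ * c i]mulrC -excess_coord.
  rewrite [X in _ = X + _](_ : _ = \sum_s (t == s)%:R * W s i).
    by rewrite -big_split/=; apply: eq_bigr => s _; rewrite [N _ _]mxE; ring.
  rewrite (bigD1 t)//= eqxx mul1r big1 ?addr0// => s st.
  by rewrite eq_sym (negbTE st) mul0r.
have zE : z i = r i + Q i i *: f (emb i) by rewrite subrK.
have : ip (z i) (z i) = Q i i ^+ 2.
  rewrite zE (form_line DL ipP)// residual_null (formC ipP (Dr i))// residual_orth f1 eqxx mulr1n.
  by ring.
by rewrite zz expr2 => /mulfI <-//; rewrite gt_eqF.
Qed.

Lemma penalized_minimizer_structure : exists V : 'M[R]_d, V *m V^T = 1%:M /\
  forall t, let w := u t - \sum_i
    (V *m diag_mx (\row_i Num.sqrt (1 + c i))) t i *: f (emb i) in ip w w = 0.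
Proof.
pose s i := Num.sqrt (1 + c i).
have s0 i : 0 < s i by rewrite sqrtr_gt0 -Q_eigenvalue.
have ss i : s i * s i = Q i i.
  by rewrite -expr2 sqr_sqrtr -Q_eigenvalue// ltW.
(* The columns of [W] are orthogonal with squared lengths Q_ii = s_i^2; dividing by s_i makes them
   orthonormal, and V S = W. *)
pose V := W *m diag_mx (\row_i (s i)^-1).
have VE t i : V t i = W t i / s i by rewrite /V mul_mx_diag !mxE.
exists V; split.
  apply: mulmx1C; apply/matrixP => i j; rewrite !mxE.
  rewrite (eq_bigr (fun t => (s i)^-1 * (s j)^-1 * (W t i * W t j))); last first.
    by move=> t _; rewrite mxE !VE; ring.
  rewrite -mulr_sumr -QE; have [->|ij] := eqVneq i j; last by rewrite Q_diag// mulr0.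
  by rewrite -ss mulr1n; field; rewrite gt_eqF.
(* This inverts the passage from [u] to [z]: u_t is the sum of (W_ti / Q_ii) z_i, so u_t minus its
   claimed value is the same combination of the null vectors [r i]. *)
have WW : W *m diag_mx (\row_i (Q i i)^-1) *m W^T = 1%:M.
  rewrite -mulmxA; apply: mulmx1C; rewrite -mulmxA -/Q mul_diag_mx.
  apply/matrixP => i j; rewrite [LHS]mxE [X in X * _]mxE [RHS]mxE.
  have [->|ij] := eqVneq i j; last by rewrite (Q_diag ij) mulr0.
  by rewrite mulVf// gt_eqF.
move=> t w.
have Df' i : D (f (emb i)) by [].
have -> : w = \sum_i (W t i / Q i i) *: r i.
  have tE : u t = \sum_i (W t i / Q i i) *: z i.
    under eq_bigr do rewrite scaler_sumr.
    rewrite exchange_big/= (bigD1 t)//= [X in _ + X]big1 ?addr0.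
      rewrite -[LHS]scale1r.
      under eq_bigr do rewrite scalerA; rewrite -scaler_suml; congr (_ *: _).
      move/matrixP/(_ t t): WW; rewrite !mxE eqxx mulr1n => <-.
      by apply: eq_bigr => i _; rewrite mul_mx_diag !mxE.
    move=> t' t't; under eq_bigr do rewrite scalerA.
    rewrite -scaler_suml -[RHS](scale0r (u t')); congr (_ *: _).
    move/matrixP/(_ t t'): WW; rewrite !mxE eq_sym (negbTE t't) mulr0n => WW0; rewrite -[RHS]WW0.
    by apply: eq_bigr => i _; rewrite mul_mx_diag !mxE.
  rewrite /w {1}tE -sumrB; apply: eq_bigr => i _.
  rewrite /r scalerBr scalerA; congr (_ - _ *: _).
  rewrite divfK ?gt_eqF// mul_mx_diag [LHS]mxE VE [X in _ * X]mxE.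
  by rewrite divfK// gt_eqF.
have Dsum : D (\sum_i (W t i / Q i i) *: r i) by exact: lin_closed_sum.
rewrite (form_suml DL ipP)// big1// => i _.
by rewrite (form_null DL ipP)// mulr0.
Qed.

End structure.

(** * Conditional expectations *)

Section integral_facts.
Context d (T : measurableType d) (R : realType) (P : probability T R).
Implicit Types (A B : set T) (U V : T -> R).

Lemma integral_indicM A V :
  (\int[P]_w (\1_A w * V w)%:E = \int[P]_(w in A) (V w)%:E)%E.
Proof.
rewrite [RHS]integral_mkcond; apply: eq_integral => w _.
by rewrite patchE indicE; case: ifP => _; rewrite ?mul1r ?mul0r.
Qed.

Lemma integrable_EFinZ (a : R) V : P.-integrable [set: T] (EFin \o V) ->
  P.-integrable [set: T] (EFin \o (fun w => a * V w)).
Proof. by move=> iV; apply: eq_integrable (integrableZl measurableT a iV). Qed.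

Lemma integrable_EFinD U V : P.-integrable [set: T] (EFin \o U) ->
  P.-integrable [set: T] (EFin \o V) ->
  P.-integrable [set: T] (EFin \o (fun w => U w + V w)).
Proof. by move=> iU iV; apply: eq_integrable (integrableD measurableT iU iV). Qed.

Lemma integrable_EFinB U V : P.-integrable [set: T] (EFin \o U) ->
  P.-integrable [set: T] (EFin \o V) ->
  P.-integrable [set: T] (EFin \o (fun w => U w - V w)).
Proof. by move=> iU iV; apply: eq_integrable (integrableB measurableT iU iV). Qed.

Lemma integrable_EFin_cst (a : R) : P.-integrable [set: T] (EFin \o (fun=> a)).
Proof. exact: finite_measure_integrable_cst. Qed.

Lemma integrable_EFin_le U V : measurable_fun [set: T] V ->
  P.-integrable [set: T] (EFin \o U) -> (forall w, `|V w| <= `|U w|) ->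
  P.-integrable [set: T] (EFin \o V).
Proof.
move=> mV iU VU; apply: (le_integrable measurableT _ _ iU).
  exact/measurable_EFinP.
by move=> w _; rewrite /= lee_fin.
Qed.

Lemma integrable_bndM (c : R) U V : measurable_fun [set: T] U ->
  (forall w, `|U w| <= c) -> P.-integrable [set: T] (EFin \o V) ->
  P.-integrable [set: T] (EFin \o (fun w => U w * V w)).
Proof.
move=> mU Uc iV; have c0 : 0 <= c by apply: le_trans (normr_ge0 (U point)) (Uc _).
apply: (integrable_EFin_le _ (integrable_EFinZ c iV)) => [|w].
  apply: measurable_funM => //; apply/measurable_EFinP.
  exact: measurable_int iV.
by rewrite !normrM (ger0_norm c0) ler_wpM2r.
Qed.

Lemma integrable_indicM A V : measurable A ->
  P.-integrable [set: T] (EFin \o V) ->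
  P.-integrable [set: T] (EFin \o (fun w => \1_A w * V w)).
Proof.
move=> mA; apply: (integrable_bndM (c := 1)) => [|w]; first exact: measurable_indic.
by rewrite indicE; case: (_ \in _); rewrite ?normr1 ?normr0.
Qed.

Lemma integral_EFinZ A (a : R) V : measurable A ->
  P.-integrable [set: T] (EFin \o V) ->
  (\int[P]_(w in A) (a * V w)%:E = a%:E * \int[P]_(w in A) (V w)%:E)%E.
Proof.
move=> mA iV; under eq_integral do rewrite EFinM; rewrite integralZl//.
exact: integrableS iV.
Qed.

Lemma integral_EFinD A U V : measurable A ->
  P.-integrable [set: T] (EFin \o U) -> P.-integrable [set: T] (EFin \o V) ->
  (\int[P]_(w in A) (U w + V w)%:E =
   \int[P]_(w in A) (U w)%:E + \int[P]_(w in A) (V w)%:E)%E.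
Proof.
by move=> mA iU iV; rewrite integralD_EFin//; [exact: integrableS iU|exact: integrableS iV].
Qed.

Lemma integral_EFinB A U V : measurable A ->
  P.-integrable [set: T] (EFin \o U) -> P.-integrable [set: T] (EFin \o V) ->
  (\int[P]_(w in A) (U w - V w)%:E =
   \int[P]_(w in A) (U w)%:E - \int[P]_(w in A) (V w)%:E)%E.
Proof.
by move=> mA iU iV; rewrite integralB_EFin//; [exact: integrableS iU|exact: integrableS iV].
Qed.

Lemma integral_fin_numT A V : measurable A -> P.-integrable [set: T] (EFin \o V) ->
  (\int[P]_(w in A) (V w)%:E)%E \is a fin_num.
Proof. by move=> mA iV; apply: integrable_fin_num => //; exact: integrableS iV. Qed.

Lemma integrable_measurable_fun V : P.-integrable [set: T] (EFin \o V) ->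
  measurable_fun [set: T] V.
Proof. by move=> iV; apply/measurable_EFinP; exact: measurable_int iV. Qed.

End integral_facts.

(** * Pulling a function of Z out of an integral *)

Section orthogonality.
Context d (T : measurableType d) (R : realType) (P : probability T R).
Context d3 (T3 : measurableType d3) (Z : {mfun T >-> T3}).
Implicit Types (V : T -> R) (u : T3 -> R).

Import HBSimple.
Import HBNNSimple.

Lemma integral_mul_preimage0_nnsfun V (g : {nnsfun T3 >-> R}) :
  P.-integrable [set: T] (EFin \o V) ->
  (forall B, measurable B -> \int[P]_(w in Z @^-1` B) (V w)%:E = 0)%E ->
  (\int[P]_w (g (Z w) * V w)%:E = 0)%E.
Proof.
move=> iV V0; pose s : seq R := finmap.enum_fset (fset_set (range g)).
transitivity (\int[P]_w (\sum_(i < size s)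
    (nth 0 s i * (\1_(Z @^-1` (g @^-1` [set nth 0 s i])) w * V w))%:E))%E.
  apply: eq_integral => w _; rewrite sumEFin fimfunEord mulr_suml; congr EFin.
  by apply: eq_bigr => i _; rewrite mulrA.
have mA i : measurable (Z @^-1` (g @^-1` [set nth 0 s i])).
  by apply: measurable_funPTI; exact: measurable_funPTI.
rewrite integral_sum//=; last first.
  by move=> i; apply: integrable_EFinZ; exact: integrable_indicM.
apply: big1 => i _; rewrite integral_EFinZ//; last exact: integrable_indicM.
rewrite integral_indicM V0 ?mule0//; exact: measurable_funPTI.
Qed.

(** Simple functions increase to [u], and |u(Z) V| dominates their products with V, so integrability
    of the product replaces any bound on [u]. *)
Lemma integral_mul_preimage0_ge0 V u : measurable_fun [set: T3] u ->
  (forall x, 0 <= u x) ->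
  P.-integrable [set: T] (EFin \o V) ->
  P.-integrable [set: T] (EFin \o (fun w => u (Z w) * V w)) ->
  (forall B, measurable B -> \int[P]_(w in Z @^-1` B) (V w)%:E = 0)%E ->
  (\int[P]_w (u (Z w) * V w)%:E = 0)%E.
Proof.
move=> mu u0 iV iuV V0.
have meu : measurable_fun [set: T3] (EFin \o u) by exact/measurable_EFinP.
pose g := nnsfun_approx measurableT meu.
have gu x n : g n x <= u x.
  rewrite -lee_fin [leLHS](_ : _ = (approx setT (EFin \o u) n x)%:E).
    by apply: le_approx => // ? _; rewrite lee_fin.
  by rewrite -(nnsfun_approxE measurableT meu).
have mV := integrable_measurable_fun iV.
have mgV n : measurable_fun [set: T] (fun w => (g n (Z w) * V w)%:E).
  apply/measurable_EFinP; apply: measurable_funM => //.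
  by apply: measurableT_comp.
have := @dominated_convergence _ _ _ P setT measurableT
  (fun n w => (g n (Z w) * V w)%:E) (fun w => (u (Z w) * V w)%:E)
  (fun w => `|u (Z w) * V w|%:E) mgV (measurable_int _ iuV).
case=> [| | |_ _].
- apply: aeW => w _.
  have : EFin \o g ^~ (Z w) @ \oo --> (u (Z w))%:E.
    by apply: (cvg_nnsfun_approx measurableT meu) => // x _; rewrite lee_fin.
  move=> gcv; under eq_fun do rewrite EFinM.
  by rewrite EFinM; exact: cvgeZr.
- exact: integrable_norm.
- apply: aeW => w n _; rewrite /= lee_fin !normrM ler_wpM2r//.
  by rewrite !ger0_norm//.
under eq_fun do rewrite integral_mul_preimage0_nnsfun//.
by move=> h; apply/esym/(cvg_unique _ (cvg_cst 0%E) h).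
Qed.

(* The pull-out property E[u(Z) V] = E[u(Z) E[V | Z]] when E[V | Z] = 0. *)
Lemma integral_mul_preimage0 V u : measurable_fun [set: T3] u ->
  P.-integrable [set: T] (EFin \o V) ->
  P.-integrable [set: T] (EFin \o (fun w => u (Z w) * V w)) ->
  (forall B, measurable B -> \int[P]_(w in Z @^-1` B) (V w)%:E = 0)%E ->
  (\int[P]_w (u (Z w) * V w)%:E = 0)%E.
Proof.
move=> mu iV iuV V0.
pose up := u^\+%R; pose un := u^\-%R.
have mup : measurable_fun setT up by exact: measurable_funrpos.
have mun : measurable_fun setT un by exact: measurable_funrneg.
have uE x : u x = up x - un x by rewrite -[in LHS](funrposBneg u).
have mV := integrable_measurable_fun iV.
have ip : P.-integrable [set: T] (EFin \o (fun w => up (Z w) * V w)).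
  apply: integrable_EFin_le iuV _ => [|w].
    by apply: measurable_funM => //; exact: measurableT_comp.
  rewrite !normrM ler_wpM2r// ger0_norm ?funrpos_ge0//.
  by rewrite /up /funrpos ge_max normr_ge0 ler_norm.
have in_ : P.-integrable [set: T] (EFin \o (fun w => un (Z w) * V w)).
  apply: integrable_EFin_le iuV _ => [|w].
    by apply: measurable_funM => //; exact: measurableT_comp.
  rewrite !normrM ler_wpM2r// ger0_norm ?funrneg_ge0//.
  by rewrite /un /funrneg ge_max normr_ge0 -normrN ler_norm.
under eq_integral do rewrite uE mulrBl.
rewrite integral_EFinB// !integral_mul_preimage0_ge0 ?sube0// => x.
  exact: funrneg_ge0.
exact: funrpos_ge0.
Qed.

End orthogonality.

Section dynkin.
Context d (T : measurableType d) (R : realType) (P : probability T R).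
Context d3 (T3 : measurableType d3) (Z : {mfun T >-> T3}).

(** The sets B over whose preimage V integrates to zero form a Dynkin system; the zero total
    integral is what closes it under complements. *)
Lemma integral_preimage0_dynkin (V : T -> R) (G : set (set T3)) :
  @measurable _ T3 = <<s G >> -> setI_closed G ->
  P.-integrable [set: T] (EFin \o V) ->
  (\int[P]_w (V w)%:E = 0)%E ->
  (forall B, G B -> \int[P]_(w in Z @^-1` B) (V w)%:E = 0)%E ->
  forall B, measurable B -> (\int[P]_(w in Z @^-1` B) (V w)%:E = 0)%E.
Proof.
move=> GE GI iV VT VG B; rewrite GE; move: B.
apply: dynkin_induction => //.
- move=> B mB B0; rewrite preimage_setC.
  have mZB : measurable (Z @^-1` B) by exact: measurable_funPTI.
  have := VT; rewrite -(setUv (Z @^-1` B)) integral_setU_EFin//; last first.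
    + exact/disj_set2P/setICr.
    + rewrite setUv; exact: integrable_measurable_fun iV.
    + exact: measurableC.
  by rewrite B0 add0e.
- move=> F mF tF F0; rewrite preimage_bigcup.
  rewrite integral_bigcup.
  + by rewrite eseries0// => i _ _; exact: F0.
  + apply/trivIsetP => /= i j _ _ ij; rewrite -preimage_setI.
    by move/trivIsetP : tF => /(_ _ _ _ _ ij) ->//; rewrite preimage_set0.
  + by move=> k; exact: measurable_funPTI.
  + apply: integrableS iV => //; apply: bigcupT_measurable => k.
    exact: measurable_funPTI.
Qed.

End dynkin.

(** * Conditional expectations given Z as functions of Z *)

Section factor.
Context d (T : measurableType d) (R : realType) (P : probability T R).
Context d3 (T3 : measurableType d3) (Z : {mfun T >-> T3}).
Local Notation G := (g_sigma_algebra_preimage Z).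

Lemma preimage_sigma_fieldP A : G A <-> exists2 B, measurable B & A = Z @^-1` B.
Proof.
split; first by move=> [B mB <-]; exists B; rewrite ?setTI.
by move=> [B mB ->]; exists B; rewrite ?setTI.
Qed.

Lemma preimage_sigma_field_measurable A : G A -> measurable A.
Proof. by move=> /preimage_sigma_fieldP[B mB ->]; exact: measurable_funPTI. Qed.

Lemma wrt_preimageP (V : T -> R) : wrt_sigma_field G V <->
  measurable_fun [set: g_sigma_algebra_preimageType Z] V.
Proof.
split=> [GV _ B mB|mV B mB]; first by rewrite setTI; exact: GV.
by have := mV measurableT B mB; rewrite setTI.
Qed.

Lemma wrt_preimage_measurable (V : T -> R) : wrt_sigma_field G V ->
  measurable_fun [set: T] V.
Proof.
by move=> GV _ B mB; rewrite setTI; apply: preimage_sigma_field_measurable; exact: GV.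
Qed.

Lemma wrt_preimage_comp (k : T3 -> R) : measurable_fun [set: T3] k ->
  wrt_sigma_field G (k \o Z).
Proof.
move=> mk B mB; apply/preimage_sigma_fieldP; exists (k @^-1` B) => //.
by rewrite -[X in measurable X]setTI; exact: mk.
Qed.

(** Test the hypothesis on the event V > c itself: V - c is positive there and has integral at most
    0, so the event is null. *)
Lemma wrt_preimage_le_ae (V : T -> R) (c : R) : wrt_sigma_field G V ->
  P.-integrable [set: T] (EFin \o V) ->
  (forall A, G A -> \int[P]_(w in A) (V w)%:E <= c%:E * P A)%E ->
  \forall w \ae P, V w <= c.
Proof.
move=> GV iV Vc; pose A := V @^-1` `]c, +oo[.
have GA : G A by apply: GV; exact: measurable_itv.
have mA := preimage_sigma_field_measurable GA.
have iVc : P.-integrable [set: T] (EFin \o (fun w => V w - c)).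
  by apply: integrable_EFinB => //; exact: integrable_EFin_cst.
have cA w : A w -> c < V w by rewrite /A /= in_itv/= andbT.
have : (\int[P]_(w in A) (V w - c)%:E <= 0)%E.
  rewrite integral_EFinB//; last exact: integrable_EFin_cst.
  rewrite integral_cst// leeBlDr ?add0e; first exact: Vc.
  by rewrite fin_numM ?fin_num_measure.
move=> le0.
have : (\int[P]_(w in A) `|(V w - c)%:E| = 0)%E.
  apply/eqP; rewrite eq_le integral_ge0 ?andbT//.
  rewrite (eq_integral (fun w => (V w - c)%:E))// => w /set_mem/cA cw.
  by rewrite gee0_abs// lee_fin subr_ge0 ltW.
move/(ae_eq_integral_abs P mA (measurable_funTS (measurable_int _ iVc))).1.
apply: filterS => w h.
rewrite leNgt; apply/negP => cw; have Aw : A w by rewrite /A /= in_itv/= andbT.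
by have [] := h Aw => /eqP; rewrite subr_eq0 gt_eqF.
Qed.

Lemma wrt_preimage_norm_le_ae (V : T -> R) (c : R) : wrt_sigma_field G V ->
  P.-integrable [set: T] (EFin \o V) ->
  (forall A, G A -> `|\int[P]_(w in A) (V w)%:E| <= c%:E * P A)%E ->
  \forall w \ae P, `|V w| <= c.
Proof.
move=> GV iV Vc.
have h1 : \forall w \ae P, V w <= c.
  apply: wrt_preimage_le_ae => // A GA; apply: le_trans (lee_abs _) _; exact: Vc.
have h2 : \forall w \ae P, - V w <= c.
  have GNV : wrt_sigma_field G (fun w => - V w).
    by apply/wrt_preimageP; apply: measurableT_comp => //; exact/wrt_preimageP.
  apply: wrt_preimage_le_ae => // [|A GA].
    rewrite (_ : EFin \o _ = EFin \o (fun w => -1 * V w)).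
      exact: integrable_EFinZ.
    by apply/funext => w; rewrite /= mulN1r.
  have mA := preimage_sigma_field_measurable GA.
  under eq_integral do rewrite -mulN1r.
  rewrite integral_EFinZ// EFinN mulN1e; apply: le_trans (lee_abs _) _.
  by rewrite abseN; exact: Vc.
apply: filterS2 h1 h2 => w w1 w2; rewrite ler_norml w1 andbT.
by rewrite lerNl.
Qed.

Lemma wrt_preimage_unique_ae (V1 V2 : T -> R) :
  wrt_sigma_field G V1 -> wrt_sigma_field G V2 ->
  P.-integrable [set: T] (EFin \o V1) -> P.-integrable [set: T] (EFin \o V2) ->
  (forall A, G A -> \int[P]_(w in A) (V1 w)%:E = \int[P]_(w in A) (V2 w)%:E)%E ->
  \forall w \ae P, V1 w = V2 w.
Proof.
move=> G1 G2 i1 i2 V12.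
have GB : wrt_sigma_field G (fun w => V1 w - V2 w).
  by apply/wrt_preimageP; apply: measurable_funB; exact/wrt_preimageP.
have : \forall w \ae P, `|V1 w - V2 w| <= 0.
  apply: wrt_preimage_norm_le_ae => // [|A GA]; first exact: integrable_EFinB.
  have mA := preimage_sigma_field_measurable GA.
  by rewrite integral_EFinB// V12// subee ?abse0 ?mul0e// integral_fin_numT.
by apply: filterS => w; rewrite normr_le0 subr_eq0 => /eqP.
Qed.

(** The Radon-Nikodym theorem is applied on the target space, to the image of the signed measure U.P
    and the law of Z. The density comes out as a function k on the target, so no separate
    Doob-Dynkin factorization is needed. *)
Lemma cond_exp_factor (U : T -> R) : P.-integrable [set: T] (EFin \o U) ->
  exists k : T3 -> R, [/\ measurable_fun [set: T3] k,
    P.-integrable [set: T] (EFin \o (k \o Z)) &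
    forall B, measurable B ->
      (\int[P]_(w in Z @^-1` B) (k (Z w))%:E = \int[P]_(w in Z @^-1` B) (U w)%:E)%E].
Proof.
move=> iU; have mZ : measurable_fun setT Z by [].
pose nu : {charge set T3 -> \bar R} :=
  measure_function_pushforward__canonical__charge_Charge (induced_charge iU) mZ.
have nuE B : nu B = (\int[P]_(w in Z @^-1` B) (U w)%:E)%E by [].
have nuP : nu `<< distribution P Z.
  apply/null_content_dominatesP => B mB PB; rewrite nuE.
  have mZB : measurable (Z @^-1` B) by exact: measurable_funPTI.
  apply: null_set_integral => //.
  by apply: measurable_funTS; exact: measurable_int iU.
pose k := fine \o (Radon_Nikodym nu (distribution P Z)).
have kE : EFin \o k = Radon_Nikodym nu (distribution P Z).
  by apply/funext => x /=; rewrite fineK// Radon_Nikodym_fin_num.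
have ik : (distribution P Z).-integrable [set: T3] (EFin \o k).
  by rewrite kE; exact: Radon_Nikodym_integrable.
have mk : measurable_fun [set: T3] k by exact/measurable_EFinP/measurable_int/ik.
have ikZ : P.-integrable [set: T] (EFin \o (k \o Z)).
  apply/integrableP; split.
    by apply/measurable_EFinP; exact: measurableT_comp.
  move/integrableP : ik => [mek]; rewrite ge0_integral_distribution//.
  by apply: measurableT_comp.
exists k; split => // B mB.
rewrite -nuE (Radon_Nikodym_integral nuP mB) -kE integral_pushforward//.
  exact/measurable_EFinP.
by apply: integrableS ikZ => //; exact: measurable_funPTI.
Qed.

End factor.

Section cond_exp_facts.
Context d (T : measurableType d) (R : realType) (P : probability T R).
Implicit Types U V : T -> R.

Lemma integrable_ae_eq U V : measurable_fun [set: T] V ->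
  P.-integrable [set: T] (EFin \o U) -> (\forall w \ae P, U w = V w) ->
  P.-integrable [set: T] (EFin \o V).
Proof.
move=> mV /integrableP[mU iU] UV; apply/integrableP; split.
  exact/measurable_EFinP.
rewrite (_ : (\int[P]_w `|(EFin \o V) w| = \int[P]_w `|(EFin \o U) w|)%E)//.
apply: ae_eq_integral => //.
- by apply: measurableT_comp => //; exact/measurable_EFinP.
- by apply: measurableT_comp => //.
- by apply: filterS UV => w /= ->.
Qed.

Lemma integral_ae_eq_EFin A U V : measurable A ->
  measurable_fun [set: T] U -> measurable_fun [set: T] V ->
  (\forall w \ae P, U w = V w) ->
  (\int[P]_(w in A) (U w)%:E = \int[P]_(w in A) (V w)%:E)%E.
Proof.
move=> mA mU mV UV; apply: ae_eq_integral => //.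
- by apply: measurable_funTS; exact/measurable_EFinP.
- by apply: measurable_funTS; exact/measurable_EFinP.
- by apply: filterS UV => w /= ->.
Qed.

Context d3 (T3 : measurableType d3) (Z : {mfun T >-> T3}).
Local Notation G := (g_sigma_algebra_preimage Z).

Lemma cond_exp_factor_version U (k : T3 -> R) : measurable_fun [set: T3] k ->
  P.-integrable [set: T] (EFin \o (k \o Z)) ->
  (forall B, measurable B ->
    (\int[P]_(w in Z @^-1` B) (k (Z w))%:E = \int[P]_(w in Z @^-1` B) (U w)%:E)%E) ->
  cond_exp_version P G U (k \o Z).
Proof.
move=> mk ik kU; split => //; first exact: wrt_preimage_comp.
by move=> A /preimage_sigma_fieldP[B mB ->]; exact: kU.
Qed.

(** Existence of the version [k \o Z] makes the chosen [cond_exp] a true version; the default of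
    [xget] never enters. *)
Lemma cond_expP U : P.-integrable [set: T] (EFin \o U) ->
  cond_exp_version P G U (cond_exp P G U).
Proof.
move=> iU; have [k [mk ik kU]] := cond_exp_factor Z iU.
by rewrite /cond_exp; apply: (xgetPex (cst 0)); exists (k \o Z);
  exact: cond_exp_factor_version.
Qed.

Lemma cond_exp_version_unique U1 U2 V1 V2 :
  (forall A, G A -> \int[P]_(w in A) (U1 w)%:E = \int[P]_(w in A) (U2 w)%:E)%E ->
  cond_exp_version P G U1 V1 -> cond_exp_version P G U2 V2 ->
  \forall w \ae P, V1 w = V2 w.
Proof.
move=> U12 [w1 i1 e1] [w2 i2 e2]; apply: (wrt_preimage_unique_ae (Z := Z)) => // A GA.
by rewrite e1// e2// U12.
Qed.

(** The bound on [k] is pointwise, not just almost sure, so that k(Z) times any integrable function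
    is integrable. It is obtained by truncating the factor to [-c, c], a change on a null set
    only. *)
Lemma cond_exp_factor_bounded U (c : R) : measurable_fun [set: T] U ->
  (forall w, `|U w| <= c) ->
  exists k : T3 -> R, [/\ measurable_fun [set: T3] k,
    (forall x, `|k x| <= c) & cond_exp_version P G U (k \o Z)].
Proof.
move=> mU Uc.
have iU : P.-integrable [set: T] (EFin \o U).
  rewrite (_ : EFin \o U = EFin \o (fun w => U w * 1)).
    by apply: (integrable_bndM mU Uc); exact: integrable_EFin_cst.
  by apply/funext => w /=; rewrite mulr1.
have c0 : 0 <= c by apply: le_trans (normr_ge0 (U point)) (Uc _).
have [k [mk ik kU]] := cond_exp_factor Z iU.
have kc : \forall w \ae P, `|k (Z w)| <= c.
  apply: (wrt_preimage_norm_le_ae (wrt_preimage_comp Z mk) ik) => A GA.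
  have mA := preimage_sigma_field_measurable GA.
  have [B mB AE] := (preimage_sigma_fieldP Z A).1 GA.
  rewrite AE kU// -AE; apply: le_trans.
    apply: le_abse_integral => //; apply: measurable_funTS; exact: measurable_int iU.
  rewrite -integral_cst//; apply: ge0_le_integral => //=.
  - by apply: measurable_funTS; apply/measurable_EFinP; exact: measurableT_comp.
  - by move=> w _; rewrite lee_fin.
pose k' x := Num.max (- c) (Num.min c (k x)).
have mk' : measurable_fun [set: T3] k'.
  by apply: measurable_maxr => //; apply: measurable_minr.
have k'c x : `|k' x| <= c.
  rewrite ler_norml /k' le_max lexx/= ge_max ge_min lexx/= andbT.
  by rewrite lerNl (le_trans _ c0)// oppr_le0.
have kk' : \forall w \ae P, k (Z w) = k' (Z w).
  apply: filterS kc => w; rewrite ler_norml => /andP[c1 c2].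
  by rewrite /k' (min_r c2) (max_r c1).
have mkZ : measurable_fun [set: T] (k \o Z) by exact: measurableT_comp.
have mk'Z : measurable_fun [set: T] (k' \o Z) by exact: measurableT_comp.
exists k'; split => //; apply: cond_exp_factor_version => //.
  exact: integrable_ae_eq kk'.
by move=> B mB; rewrite -kU//; apply/esym/integral_ae_eq_EFin => //; exact: measurable_funPTI.
Qed.

End cond_exp_facts.

Section Lfun2.
Context d (T : measurableType d) (R : realType) (P : probability T R).

Lemma Lfun2P (f : T -> R) : f \in Lfun P 2%:E <->
  measurable_fun [set: T] f /\
  P.-integrable [set: T] (EFin \o (fun x => f x ^+ 2)).
Proof.
split=> [Lf|[mf /integrableP[_ i2]]].
  split; last exact: Lfun2_integrable_sqr.
  by move: Lf; rewrite inE => /andP[+ _]; rewrite inE.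
rewrite inE; apply/andP; split; rewrite inE//= /finite_norm unlock.
apply: poweR_lty; apply: le_lt_trans i2; rewrite le_eqVlt; apply/orP; left.
apply/eqP/eq_integral => x _ /=.
by rewrite powR_mulrn// normrX.
Qed.

Lemma integrable_sqrt (f : T -> R) : measurable_fun [set: T] f ->
  P.-integrable [set: T] (EFin \o (fun x => f x ^+ 2)) ->
  P.-integrable [set: T] (EFin \o f).
Proof.
move=> mf i2; apply: (integrable_EFin_le (U := fun x => 1 + f x ^+ 2)) => //.
  by apply: integrable_EFinD => //; exact: integrable_EFin_cst.
move=> x; rewrite [leRHS]ger0_norm; last by rewrite addr_ge0// sqr_ge0.
rewrite -real_normK ?num_real//; set t := `|f x|.
have t0 : 0 <= t := normr_ge0 _.
have := sqr_ge0 (t - 1); rewrite sqrrB1 => h.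
have : t *+ 2 <= t ^+ 2 + 1 by rewrite -subr_ge0 addrAC.
rewrite addrC; apply: le_trans; rewrite mulr2n ler_wpDl//.
Qed.

Lemma integrable_mul_sqr (f g : T -> R) : measurable_fun [set: T] f ->
  measurable_fun [set: T] g ->
  P.-integrable [set: T] (EFin \o (fun x => f x ^+ 2)) ->
  P.-integrable [set: T] (EFin \o (fun x => g x ^+ 2)) ->
  P.-integrable [set: T] (EFin \o (fun x => f x * g x)).
Proof.
move=> mf mg f2 g2; apply: (integrable_EFin_le (U := fun x => f x ^+ 2 + g x ^+ 2)).
- exact: measurable_funM.
- exact: integrable_EFinD.
move=> x; rewrite [leRHS]ger0_norm ?addr_ge0 ?sqr_ge0//.
rewrite -(real_normK (num_real (f x))) -(real_normK (num_real (g x))) normrM.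
set s := `|f x|; set t := `|g x|.
have : s * t *+ 2 <= s ^+ 2 + t ^+ 2 by rewrite -subr_ge0 addrAC -sqrrB sqr_ge0.
apply: le_trans; rewrite mulr2n ler_wpDl//; exact: mulr_ge0 (normr_ge0 _) (normr_ge0 _).
Qed.

End Lfun2.

(** * The Frechet cumulative covariance form *)

Section metric_measurability.
Context (R : realType) (M : pmetricType R).

Lemma separable_dense_seq : separable_space M ->
  exists z : nat -> M, forall (x : M) (e : R), 0 < e ->
    exists n, mdist x (z n) < e.
Proof.
move=> [D /countable_injP[f finj] dD].
(* [f] codes the countable dense set injectively; an index that is no code yields the default
   [point], which does no harm. *)
exists (fun n => xget point [set z | D z /\ f z = n]) => x e e0.
have [||y [By Dy]] := dD (ball x e : set M)°.
  by exists x; exact/nbhsx_ballx.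
  exact: open_interior.
exists (f y); rewrite (_ : xget _ _ = y).
  by have /interior_subset := By; rewrite ballEmdist.
apply: xget_unique => //= t [Dt ft]; exact: (finj t y (mem_set Dt) (mem_set Dy) ft).
Qed.

Lemma measurable_mdist_ball (z : M) (r : R) :
  measurable ([set y | mdist z y < r] : set (borelType M)).
Proof.
apply: sub_sigma_algebra; rewrite -ballEmdist.
rewrite openE => y /=; rewrite ballEmdist/= => yr.
apply/nbhs_ballP; exists (r - mdist z y) => /=; first by rewrite subr_gt0.
move=> t; rewrite !ballEmdist/= ltrBrDl; apply: le_lt_trans.
exact: metric_triangle.
Qed.

(** The sigma-field here is the product of the two Borel fields, so continuity alone is not enough.
    Separability writes each set d(x, y) < r as a countable union of products of balls. *)
Lemma measurable_mdist : separable_space M ->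
  measurable_fun [set: borelType M * borelType M]
    (fun p : borelType M * borelType M => mdist (p.1 : M) p.2).
Proof.
move=> /separable_dense_seq[z zd] _.
apply: (measurability _ (RGenInftyO.measurableE R)) => //.
move=> /= _ [_ [r ->] <-]; rewrite setTI.
rewrite [X in measurable X](_ : _ = \bigcup_n \bigcup_(q : rat)
  (([set y | mdist (z n) y < ratr q] : set (borelType M)) `*`
   ([set y | mdist (z n) y < r - ratr q] : set (borelType M)))).
  apply: bigcupT_measurable => n; apply: bigcupT_measurable_rat => q.
  by apply: measurableX; exact: measurable_mdist_ball.
apply/seteqP; split.
- case=> x y /=; rewrite in_itv/= => xyr.
  (* Half of the slack: d(z_n, x) is spent twice, in d(z_n, x) + d(z_n, y) <= 2 d(z_n, x) + d(x, y)
     < r, and a rational fits in the remaining gap. *)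
  have e0 : 0 < (r - mdist (x : M) y) / 2 by rewrite divr_gt0// subr_gt0.
  have [n xn] := zd x _ e0.
  have : mdist (z n) (x : M) < r - mdist (z n) y.
    have := metric_triangle (z n) x y; move: xn; rewrite (metric_sym x (z n)); lra.
  move=> /rat_in_itvoo[q]; rewrite in_itv/= => /andP[q1 q2].
  by exists n => //; exists q => //; split => //=; lra.
- case=> x y [n _ [q _ [/= h1 h2]]].
  rewrite in_itv/=; apply: le_lt_trans (metric_triangle _ (z n) _) _.
  by rewrite (metric_sym (x : M)); lra.
Qed.

End metric_measurability.

(** * Independence of the sample and the copies *)

Section model.
Context d (T : measurableType d) (R : realType) (P : probability T R).
Context d1 (T1 : measurableType d1) (M : pmetricType R).
Variables (X : {RV P >-> T1}) (Y Ybar Ytil : {RV P >-> borelType M}).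
Hypotheses (sepM : separable_space M) (indep : independent_copies X Y Ybar Ytil).

Local Notation YY := (borelType M * borelType M)%type.

Let pairZ_subproof : measurable_fun [set: T] (fun w => (Ybar w, Ytil w) : YY).
Proof. by apply: measurable_fun_pair. Qed.
(** Bundled as a measurable map so that the results on a generic [Z] apply; it unfolds to the pair
    that generates the sigma-field in [c_fun]. *)
Definition copies : {mfun T >-> YY} := mfun_Sub (mem_set pairZ_subproof).

Let pairXY_subproof : measurable_fun [set: T] (fun w => (X w, Y w) : (T1 * borelType M)%type).
Proof. by apply: measurable_fun_pair. Qed.
Definition sample : {mfun T >-> (T1 * borelType M)%type} := mfun_Sub (mem_set pairXY_subproof).

Let triple_subproof :
  measurable_fun [set: T] (fun w => (Y w, (Ybar w, Ytil w)) : (borelType M * YY)%type).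
Proof. by apply: measurable_fun_pair => //; exact: pairZ_subproof. Qed.
Definition responses : {mfun T >-> (borelType M * YY)%type} :=
  mfun_Sub (mem_set triple_subproof).

Local Notation G := (g_sigma_algebra_preimage (fun w => (Ybar w, Ytil w))).

(** By the Dynkin argument a rectangle event A of the copies suffices. There the pull-out property
    is used with the sample as conditioning variable. *)
Lemma independent_copies_integral0 (u : (T1 * borelType M)%type -> R) :
  measurable_fun setT u -> P.-integrable [set: T] (EFin \o (u \o sample)) ->
  (\int[P]_w (u (sample w))%:E = 0)%E ->
  forall C : set YY, measurable C ->
    (\int[P]_(w in copies @^-1` C) (u (sample w))%:E = 0)%E.
Proof.
move=> mu iu u0; apply: (integral_preimage0_dynkin (Z := copies) _ _ iu u0).
- exact: measurable_prod_measurableType.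
- move=> _ _ [A1 mA1 [A2 mA2 <-]] [B1 mB1 [B2 mB2 <-]].
  exists (A1 `&` B1); first exact: measurableI.
  exists (A2 `&` B2); first exact: measurableI.
  by rewrite setXI.
move=> _ [B mB [C mC <-]].
pose A := Ybar @^-1` B `&` Ytil @^-1` C.
have mA : measurable A by apply: measurableI; exact: measurable_funPTI.
have -> : copies @^-1` (B `*` C) = A by [].
pose p := fine (P A).
have PA : P A = p%:E by rewrite fineK// fin_num_measure.
(* Independence says exactly that this centered indicator integrates to zero over every event of the
   sample, so u(X, Y) can be pulled out against it. *)
pose V w := (\1_A w : R) - p.
have i1 : P.-integrable [set: T] (EFin \o (\1_A : T -> R)).
  by apply: integrable_indic.
have iV : P.-integrable [set: T] (EFin \o V).
  by apply: integrable_EFinB => //; exact: integrable_EFin_cst.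
have iuA : P.-integrable [set: T] (EFin \o (fun w => u (sample w) * \1_A w)).
  rewrite (_ : EFin \o _ = EFin \o (fun w => \1_A w * u (sample w))).
    exact: integrable_indicM.
  by apply/funext => w /=; rewrite mulrC.
have iup : P.-integrable [set: T] (EFin \o (fun w => p * u (sample w))).
  exact: integrable_EFinZ.
have uVE w : u (sample w) * V w = u (sample w) * \1_A w - p * u (sample w).
  by rewrite /V; ring.
have [_ _ ind] := indep.
have : (\int[P]_w (u (sample w) * V w)%:E = 0)%E.
  apply: (integral_mul_preimage0 (Z := sample)) => //.
    rewrite (_ : EFin \o _ = EFin \o (fun w => u (sample w) * \1_A w - p * u (sample w))).
      exact: integrable_EFinB.
    by apply/funext => w /=; rewrite uVE.
  move=> S mS; have mSS : measurable (sample @^-1` S) by exact: measurable_funPTI.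
  rewrite integral_EFinB//; last exact: integrable_EFin_cst.
  rewrite integral_indic// integral_cst// -PA.
  have PAS : P (A `&` sample @^-1` S) =
      (P (sample @^-1` S) * P (Ybar @^-1` B) * P (Ytil @^-1` C))%E.
    by rewrite -(ind S B C)// setIC /A setIA.
  have PAE : P A = (P (Ybar @^-1` B) * P (Ytil @^-1` C))%E.
    have := ind setT B C measurableT mB mC.
    by rewrite preimage_setT setTI probability_setT mul1e.
  apply: (etrans (congr2 (fun x y => x - y * _)%E PAS PAE)).
  rewrite [X in (_ - X)%E]muleC muleA subee//.
  by rewrite !fin_numM// fin_num_measure//; exact: measurable_funPTI.
under eq_integral do rewrite uVE.
rewrite integral_EFinB// integral_EFinZ// u0 mule0 sube0 => <-.
rewrite -integral_indicM; apply: eq_integral => w _; by rewrite mulrC.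
Qed.

End model.

Section c_fun_facts.
Context d (T : measurableType d) (R : realType) (P : probability T R).
Context d1 (T1 : measurableType d1) (M : pmetricType R).
Variables (X : {RV P >-> T1}) (Y Ybar Ytil : {RV P >-> borelType M}).
Hypotheses (sepM : separable_space M) (indep : independent_copies X Y Ybar Ytil).

Local Notation YY := (borelType M * borelType M)%type.
Local Notation Z := (copies Ybar Ytil).
Local Notation XY := (sample X Y).
Local Notation YZ := (responses Y Ybar Ytil).
Local Notation G := (g_sigma_algebra_preimage (fun w => (Ybar w, Ytil w))).
Local Notation D := (dist_lt Y Ybar Ytil).
Local Notation cf := (c_fun X Y Ybar Ytil).

Lemma independent_copies_integral (g : T1 -> R) : measurable_fun setT g ->
  P.-integrable [set: T] (EFin \o (g \o X)) ->
  forall A, G A ->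
    (\int[P]_(w in A) (g (X w))%:E = \int[P]_w (g (X w))%:E * P A)%E.
Proof.
move=> mg ig A /(preimage_sigma_fieldP Z A)[C mC ->].
pose e := fine (\int[P]_w (g (X w))%:E)%E.
have eE : (\int[P]_w (g (X w))%:E = e%:E)%E by rewrite fineK// integral_fin_numT.
pose u (p : (T1 * borelType M)%type) := g p.1 - e.
have mu : measurable_fun setT u.
  by apply: measurable_funB => //; exact: measurableT_comp.
have iu : P.-integrable [set: T] (EFin \o (u \o XY)).
  by apply: (integrable_EFinB ig); exact: integrable_EFin_cst.
have u0 : (\int[P]_w (u (XY w))%:E = 0)%E.
  rewrite (integral_EFinB measurableT ig (integrable_EFin_cst P e)) eE.
  by rewrite integral_cst//= probability_setT mule1 subee.
have mZC : measurable (Z @^-1` C) by exact: measurable_funPTI.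
have := independent_copies_integral0 indep mu iu u0 mC.
rewrite (integral_EFinB mZC ig (integrable_EFin_cst P e)) eE integral_cst//.
by move/eqP; rewrite sube_eq ?add0e// => [/eqP|];
  rewrite ?fin_num_adde_defl// ?integral_fin_numT// fin_numM// fin_num_measure.
Qed.

(** On a product B x C the indicator of B joins h(X): 1_B(Y) h(X) is a function of the sample with
    zero mean, hence has zero integral over the events of the copies. *)
Lemma responses_integral0 (h : T1 -> R) : measurable_fun setT h ->
  P.-integrable [set: T] (EFin \o (h \o X)) ->
  (forall B, measurable B -> \int[P]_(w in Y @^-1` B) (h (X w))%:E = 0)%E ->
  forall S, measurable S -> (\int[P]_(w in YZ @^-1` S) (h (X w))%:E = 0)%E.
Proof.
move=> mh ih h0.
apply: (integral_preimage0_dynkin (Z := YZ) _ _ ih).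
- exact: measurable_prod_measurableType.
- move=> _ _ [A1 mA1 [A2 mA2 <-]] [B1 mB1 [B2 mB2 <-]].
  exists (A1 `&` B1); first exact: measurableI.
  exists (A2 `&` B2); first exact: measurableI.
  by rewrite setXI.
- exact: (h0 setT measurableT).
move=> _ [B mB [C mC <-]].
pose u (p : (T1 * borelType M)%type) := \1_B p.2 * h p.1.
have mu : measurable_fun setT u.
  apply: measurable_funM; last exact: measurableT_comp.
  apply: (@measurableT_comp _ _ _ _ _ _ (\1_B : borelType M -> R)) => //.
have iu : P.-integrable [set: T] (EFin \o (u \o XY)).
  by apply: (@integrable_indicM _ _ _ _ (Y @^-1` B) _ _ ih); exact: measurable_funPTI.
have u0 : (\int[P]_w (u (XY w))%:E = 0)%E.
  by rewrite -(h0 _ mB) -integral_indicM.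
rewrite -[RHS](independent_copies_integral0 indep mu iu u0 mC).
rewrite -integral_indicM -[RHS]integral_indicM; apply: eq_integral => w _.
congr EFin; rewrite /u mulrA; congr (_ * _); rewrite !indicE -natrM mulnb.
congr (nat_of_bool _)%:R; apply/idP/andP => [/set_mem[/= YB ZC]|[/set_mem ZC /set_mem YB]].
  by split; exact/mem_set.
by apply/mem_set; split.
Qed.

Definition closer_set : set (borelType M * YY)%type :=
  [set q | mdist (q.1 : M) q.2.2 < mdist (q.2.1 : M) q.2.2].

Lemma measurable_closer_set : measurable closer_set.
Proof.
have md := measurable_mdist sepM.
have m1 : measurable_fun setT
    (fun q : (borelType M * YY)%type => mdist (q.1 : M) q.2.2).
  have mq : measurable_fun setT (fun q : (borelType M * YY)%type => (q.1, q.2.2)).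
    by apply: measurable_fun_pair => //; exact: measurableT_comp.
  exact: (measurableT_comp md mq).
have m2 : measurable_fun setT
    (fun q : (borelType M * YY)%type => mdist (q.2.1 : M) q.2.2).
  have mq : measurable_fun setT (fun q : (borelType M * YY)%type => q.2) by exact: measurable_snd.
  exact: (measurableT_comp md mq).
have := measurable_fun_ltr m1 m2 measurableT (Y := [set true]) I.
by rewrite setTI.
Qed.

Lemma dist_ltE : D = YZ @^-1` closer_set. Proof. by []. Qed.

Lemma measurable_dist_lt : measurable D.
Proof. by rewrite dist_ltE; apply: measurable_funPTI; exact: measurable_closer_set. Qed.

Section centered.
Variable f : T1 -> R.
Hypotheses (mf : measurable_fun setT f)
  (intf : P.-integrable [set: T] (EFin \o (f \o X)))
  (f0 : (\int[P]_w (f (X w))%:E = 0)%E).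

(** The conditional covariance becomes linear: E[f(X) | copies] = 0 by independence and centering,
    and the term with E[1_D | copies] f(X) integrates to zero over every event of the copies by the
    pull-out property. *)
Lemma c_fun_version : cond_exp_version P G (fun w => \1_D w * f (X w)) (cf f).
Proof.
have mD := measurable_dist_lt.
have iD : P.-integrable [set: T] (EFin \o (\1_D : T -> R)) by exact: integrable_indic.
have mG A : G A -> measurable A := @preimage_sigma_field_measurable _ _ _ _ Z A.
pose e := cond_exp P G (f \o X); pose q := cond_exp P G (\1_D : T -> R).
have Pe : cond_exp_version P G (f \o X) e := cond_expP Z intf.
have Pq : cond_exp_version P G (\1_D : T -> R) q := cond_expP Z iD.
have e0 : \forall w \ae P, e w = 0.
  have h : cond_exp_version P G (fun=> 0) (fun=> 0).
    by split=> // [B mB|]; [exact: (wrt_preimage_comp Z (k := fun=> 0))|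
      exact: integrable_EFin_cst].
  apply: (cond_exp_version_unique (Z := Z) _ Pe h) => A GA.
  by rewrite independent_copies_integral// f0 mul0e integral0.
have D1 w : `|(\1_D : T -> R) w| <= 1.
  by rewrite indicE; case: (_ \in _); rewrite ?normr1 ?normr0.
(* The chosen version [q] carries no pointwise bound; the bounded factor [k] replaces it, so that
   k(Z) f(X) is integrable. *)
have [k [mk k1 Pk]] := cond_exp_factor_bounded P Z (integrable_measurable_fun iD) D1.
have qk : \forall w \ae P, q w = k (Z w).
  exact: (cond_exp_version_unique (Z := Z) _ Pq Pk).
pose W w := (f (X w) - e w) * (\1_D w - q w).
pose W' w := \1_D w * f (X w) - k (Z w) * f (X w).
have iDf : P.-integrable [set: T] (EFin \o (fun w => \1_D w * f (X w))).
  exact: integrable_indicM.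
have mkZ : measurable_fun [set: T] (k \o Z) by exact: measurableT_comp.
have ikf : P.-integrable [set: T] (EFin \o (fun w => k (Z w) * f (X w))).
  by apply: (integrable_bndM (c := 1) mkZ _ intf) => w; exact: k1.
have iW' : P.-integrable [set: T] (EFin \o W') by exact: integrable_EFinB.
have mfX := integrable_measurable_fun intf.
have mW : measurable_fun [set: T] W.
  have [we _ _] := Pe; have [wq _ _] := Pq.
  apply: measurable_funM; apply: measurable_funB => //.
  - exact: (wrt_preimage_measurable (Z := Z)).
  - exact: (wrt_preimage_measurable (Z := Z)).
have WW' : \forall w \ae P, W' w = W w.
  apply: filterS2 e0 qk => w ew qw; rewrite /W /W' ew qw; ring.
have iW : P.-integrable [set: T] (EFin \o W) by exact: integrable_ae_eq WW'.
have [wc ic ec] : cond_exp_version P G W (cf f) := cond_expP Z iW.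
split => // A GA; rewrite ec//.
have mA := mG A GA.
rewrite -(integral_ae_eq_EFin mA (integrable_measurable_fun iW') mW WW').
rewrite integral_EFinB//; set x := (X in (_ - X)%E).
suff -> : x = 0%E by rewrite sube0.
have [C mC AE] := (preimage_sigma_fieldP Z A).1 GA.
rewrite /x -integral_indicM.
transitivity (\int[P]_w ((\1_C (Z w) * k (Z w)) * f (X w))%:E)%E.
  by apply: eq_integral => w _; rewrite AE mulrA.
apply: (integral_mul_preimage0 (Z := Z) (u := fun z => \1_C z * k z)) => //.
- exact: measurable_funM.
- rewrite (_ : EFin \o _ = EFin \o (fun w => \1_A w * (k (Z w) * f (X w)))).
    exact: integrable_indicM.
  by apply/funext => w /=; rewrite AE mulrA.
- move=> B mB; rewrite independent_copies_integral ?f0 ?mul0e//.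
  by apply/(preimage_sigma_fieldP Z); exists B.
Qed.

Lemma c_fun_measurable : measurable_fun [set: T] (cf f).
Proof.
by have [wc _ _] := c_fun_version; exact: (wrt_preimage_measurable (Z := Z)).
Qed.

(** The constant is E|f(X)|: over an event A of the copies, the integral of 1_D f(X) is at most that
    of |f(X)|, which is E|f(X)| P(A) by independence. This is what makes products c_f c_g
    integrable. *)
Lemma c_fun_bounded : exists c, \forall w \ae P, `|cf f w| <= c.
Proof.
have [wc ic ec] := c_fun_version.
have ifn : P.-integrable [set: T] (EFin \o ((Num.norm \o f) \o X)) := integrable_norm intf.
pose c := fine (\int[P]_w (`|f (X w)|)%:E)%E.
have cE : (\int[P]_w (`|f (X w)|)%:E = c%:E)%E.
  by rewrite fineK// (integral_fin_numT measurableT ifn).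
exists c; apply: (wrt_preimage_norm_le_ae (Z := Z) wc ic) => A GA.
have mA := preimage_sigma_field_measurable (Z := Z) GA.
rewrite ec// -cE -(independent_copies_integral (g := Num.norm \o f))//; last first.
  exact: measurableT_comp.
have iDf : P.-integrable [set: T] (EFin \o (fun w => \1_D w * f (X w))).
  by apply: integrable_indicM => //; exact: measurable_dist_lt.
apply: le_trans.
  apply: le_abse_integral => //; apply: measurable_funTS; exact: measurable_int iDf.
apply: ge0_le_integral => //=.
- apply: measurable_funTS; apply/measurable_EFinP.
  by apply: measurableT_comp => //; exact: integrable_measurable_fun iDf.
- by apply: measurable_funTS; apply/measurable_EFinP; exact: integrable_measurable_fun ifn.
- move=> w _; rewrite lee_fin normrM ler_piMl// indicE.
  by case: (_ \in _); rewrite ?normr1 ?normr0.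
Qed.

End centered.
End c_fun_facts.

(** * Centered square-integrable functions and their covariance form *)

Section L2c_facts.
Context d (T : measurableType d) (R : realType) (P : probability T R).
Context d1 (T1 : measurableType d1) (X : {RV P >-> T1}).

Lemma fine_integral_lin (a : R) (U V : T -> R) :
  P.-integrable [set: T] (EFin \o U) -> P.-integrable [set: T] (EFin \o V) ->
  fine (\int[P]_w (a * U w + V w)%:E) =
  a * fine (\int[P]_w (U w)%:E) + fine (\int[P]_w (V w)%:E).
Proof.
move=> iU iV; rewrite integral_EFinD//; last exact: integrable_EFinZ.
rewrite fineD ?integral_fin_numT//; last exact: integrable_EFinZ.
by rewrite integral_EFinZ// fineM// integral_fin_numT.
Qed.

Lemma integrable_distribution (g : T1 -> R) : measurable_fun [set: T1] g ->
  (distribution P X).-integrable [set: T1] (EFin \o g) <->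
  P.-integrable [set: T] (EFin \o (g \o X)).
Proof.
move=> mg; have mgX : measurable_fun [set: T] (g \o X) by exact: measurableT_comp.
have gE : (\int[distribution P X]_x `|(EFin \o g) x| =
           \int[P]_w `|(EFin \o (g \o X)) w|)%E.
  rewrite ge0_integral_distribution//.
  by apply: measurableT_comp => //; exact/measurable_EFinP.
split=> /integrableP[_ i]; apply/integrableP; split.
- exact/measurable_EFinP.
- by rewrite -gE.
- exact/measurable_EFinP.
- by rewrite gE.
Qed.

Lemma ae_eq_distribution (f g : T1 -> R) : measurable_fun [set: T1] f ->
  measurable_fun [set: T1] g -> (\forall w \ae P, f (X w) = g (X w)) ->
  \forall x \ae distribution P X, f x = g x.
Proof.
move=> mf mg fg.
have mN : measurable [set x | f x - g x != 0].
  have := measurable_funB mf mg measurableT (measurableC (measurable_set1 0)).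
  rewrite setTI; congr (measurable _); apply/seteqP; split => x /= /eqP//.
exists [set x | f x - g x != 0]; split => //.
  apply: (@negligibleP _ _ _ P _ _).1; first exact: measurable_funPTI.
  by apply: negligibleS fg => w /= fgN fgw; rewrite fgw subrr eqxx in fgN.
by move=> x /= fgx; rewrite subr_eq0; exact/eqP.
Qed.

Lemma L2cP (f : T1 -> R) : L2c X f <->
  [/\ measurable_fun [set: T1] f,
      P.-integrable [set: T] (EFin \o (fun w => f (X w) ^+ 2)) &
      (\int[P]_w (f (X w))%:E = 0)%E].
Proof.
rewrite /L2c unlock; split=> [[/Lfun2P[mf i2] f0]|[mf i2 f0]].
  split => //; apply/(integrable_distribution (g := fun x => f x ^+ 2)) => //.
  exact: measurable_funX.
split => //; apply/Lfun2P; split => //.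
by apply/integrable_distribution => //; exact: measurable_funX.
Qed.

Lemma L2c_integrable (f : T1 -> R) : L2c X f ->
  P.-integrable [set: T] (EFin \o (f \o X)).
Proof.
by move=> /L2cP[mf i2 _]; apply: integrable_sqrt => //; exact: measurableT_comp.
Qed.

Lemma L2c_integrableM (f g : T1 -> R) : L2c X f -> L2c X g ->
  P.-integrable [set: T] (EFin \o (fun w => f (X w) * g (X w))).
Proof.
move=> /L2cP[mf f2 _] /L2cP[mg g2 _].
by apply: (integrable_mul_sqr (f := f \o X) (g := g \o X)) => //;
  exact: measurableT_comp.
Qed.

Lemma L2c_lin_closed : lin_closed (L2c X).
Proof.
split=> [|a f g Lf Lg].
  apply/L2cP; split; first exact: measurable_cst.
    rewrite (_ : EFin \o _ = EFin \o (fun=> 0)); first exact: integrable_EFin_cst.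
    by apply/funext => w /=; rewrite expr0n.
  by under eq_integral do rewrite /=; rewrite integral0.
have iff := L2c_integrableM Lf Lf; have igg := L2c_integrableM Lg Lg.
have ifg := L2c_integrableM Lf Lg.
have [iff' igg'] := (L2c_integrable Lf, L2c_integrable Lg).
have [/L2cP[mf f2 f0] /L2cP[mg g2 g0]] := (Lf, Lg).
apply/L2cP; split.
- by apply: measurable_funD => //; exact: measurable_funM.
- rewrite (_ : EFin \o _ = EFin \o (fun w => a ^+ 2 * (f (X w) * f (X w)) +
      (2 * a * (f (X w) * g (X w)) + g (X w) * g (X w)))).
    by do 2 (apply: integrable_EFinD => //; try exact: integrable_EFinZ).
  by apply/funext => w /=; congr EFin; rewrite !fctE/= /GRing.scale/=; ring.
- rewrite (_ : (fun w => _) = (fun w => (a * (f \o X) w + (g \o X) w)%:E)); last by [].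
  rewrite integral_EFinD//; last exact: integrable_EFinZ.
  by rewrite integral_EFinZ// f0 g0 mule0 adde0.
Qed.

Definition inner_product (f g : T1 -> R) := fine (covariance P (f \o X) (g \o X)).

Lemma inner_productE f g : L2c X f -> L2c X g ->
  inner_product f g = fine (\int[P]_w (f (X w) * g (X w))%:E).
Proof.
move=> Lf Lg; rewrite /inner_product unlock.
have [_ ->] := Lf; have [_ ->] := Lg; rewrite /= unlock; congr fine.
apply: eq_integral => w _; congr EFin; rewrite -[RHS]/(f (X w) * g (X w)).
by rewrite -[LHS]/((f (X w) - 0) * (g (X w) - 0)) !subr0.
Qed.

Lemma inner_product_psd : psd_form (L2c X) inner_product.
Proof.
split=> [f g Lf Lg|a f g h Lf Lg Lh|f Lf].
- by rewrite /inner_product covarianceC.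
- rewrite !inner_productE//; last by apply: L2c_lin_closed.2.
  rewrite -fine_integral_lin ?L2c_integrableM//; congr fine; apply: eq_integral => w _.
  by congr EFin; rewrite !fctE/= /GRing.scale/=; ring.
- rewrite inner_productE// fine_ge0// integral_ge0// => w _.
  by rewrite lee_fin -expr2 sqr_ge0.
Qed.

Lemma inner_product_null f : L2c X f -> inner_product f f = 0 ->
  \forall x \ae distribution P X, f x = 0.
Proof.
move=> Lf; rewrite inner_productE// => f0.
have i2 := L2c_integrableM Lf Lf; have /L2cP[mf _ _] := Lf.
apply: ae_eq_distribution => //.
have : (\int[P]_w `|(f (X w) * f (X w))%:E| = 0)%E.
  transitivity (\int[P]_w (f (X w) * f (X w))%:E)%E.
    by apply: eq_integral => w _; rewrite gee0_abs// lee_fin -expr2 sqr_ge0.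
  by rewrite -(fineK (integral_fin_numT measurableT i2)) f0.
move/(ae_eq_integral_abs P measurableT (measurable_int _ i2)).1.
apply: filterS => w /(_ I)[/eqP]; rewrite mulf_eq0 orbb => /eqP.
by [].
Qed.

Lemma var_mxE m (f : 'I_m -> T1 -> R) i j : var_mx X f i j = inner_product (f i) (f j).
Proof. by rewrite mxE. Qed.

End L2c_facts.

Section FCCov_form.
Context d (T : measurableType d) (R : realType) (P : probability T R).
Context d1 (T1 : measurableType d1) (M : pmetricType R).
Variables (X : {RV P >-> T1}) (Y Ybar Ytil : {RV P >-> borelType M}).
Hypotheses (sepM : separable_space M) (indep : independent_copies X Y Ybar Ytil).

Local Notation Z := (copies Ybar Ytil).
Local Notation G := (g_sigma_algebra_preimage (fun w => (Ybar w, Ytil w))).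
Local Notation D := (dist_lt Y Ybar Ytil).
Local Notation cf := (c_fun X Y Ybar Ytil).
Local Notation B := (FCCov2 X Y Ybar Ytil).

Lemma L2c_c_fun_version f : L2c X f ->
  cond_exp_version P G (fun w => \1_D w * f (X w)) (cf f).
Proof.
move=> Lf; have /L2cP[mf _ f0] := Lf.
exact: c_fun_version (L2c_integrable Lf) f0.
Qed.

Lemma L2c_c_fun_measurable f : L2c X f -> measurable_fun [set: T] (cf f).
Proof.
move=> Lf; have /L2cP[mf _ f0] := Lf.
exact: c_fun_measurable (L2c_integrable Lf) f0.
Qed.

Lemma c_fun_integrableM f g : L2c X f -> L2c X g ->
  P.-integrable [set: T] (EFin \o (fun w => cf f w * cf g w)).
Proof.
move=> Lf Lg; have /L2cP[mf _ f0] := Lf.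
have [c fc] := c_fun_bounded sepM indep mf (L2c_integrable Lf) f0.
have [_ ig _] := L2c_c_fun_version Lg.
have [mcf mcg] := (L2c_c_fun_measurable Lf, L2c_c_fun_measurable Lg).
apply/integrableP; split.
  by apply/measurable_EFinP; exact: measurable_funM.
apply: (@le_lt_trans _ _ (\int[P]_w `|(c * cf g w)%:E|)%E); last first.
  by have /integrableP[] := integrable_EFinZ c ig.
apply: ae_ge0_le_integral => //.
- by apply/measurable_EFinP; apply: measurableT_comp => //; exact: measurable_funM.
- by apply/measurable_EFinP; apply: measurableT_comp => //; exact: measurable_funM.
- apply: filterS fc => w fw _; rewrite /= lee_fin !normrM ler_wpM2r//.
  by rewrite (le_trans fw)// ler_norm.
Qed.

(** [c_fun] is a chosen version, so linearity holds only almost surely: both sides are versions of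
    the same conditional expectation. *)
Lemma c_fun_lin (a : R) f g : L2c X f -> L2c X g ->
  \forall w \ae P, cf (a *: f + g) w = a * cf f w + cf g w.
Proof.
move=> Lf Lg.
have [wf icf ef] := L2c_c_fun_version Lf; have [wg icg eg] := L2c_c_fun_version Lg.
have mD : measurable D := measurable_dist_lt Y Ybar Ytil sepM.
have iDf := integrable_indicM mD (L2c_integrable Lf).
have iDg := integrable_indicM mD (L2c_integrable Lg).
have Lfg : L2c X (a *: f + g) by apply: (L2c_lin_closed X).2.
apply: (cond_exp_version_unique (Z := Z) _ (L2c_c_fun_version Lfg)
  (V2 := fun w => a * cf f w + cf g w)
  (U2 := fun w => a * (\1_D w * f (X w)) + \1_D w * g (X w))).
  move=> A GA; apply: eq_integral => w _; congr EFin.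
  by rewrite !fctE/= /GRing.scale/=; ring.
split.
- apply/(wrt_preimageP Z).
  have mcf := (wrt_preimageP Z (cf f)).1 wf; have mcg := (wrt_preimageP Z (cf g)).1 wg.
  exact: measurable_funD (measurable_funM (measurable_cst a) mcf) mcg.
- by apply: integrable_EFinD => //; exact: integrable_EFinZ.
- move=> A GA; have mA := preimage_sigma_field_measurable (Z := Z) GA.
  rewrite (integral_EFinD mA (integrable_EFinZ a icf) icg) (integral_EFinZ a mA icf).
  rewrite (integral_EFinD mA (integrable_EFinZ a iDf) iDg) (integral_EFinZ a mA iDf).
  exact: (congr2 (fun x y => a%:E * x + y)%E (ef A GA) (eg A GA)).
Qed.

Lemma FCCov2E f g : B f g = fine (\int[P]_w (cf f w * cf g w)%:E).
Proof. by rewrite /FCCov2 unlock. Qed.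

Lemma FCCov2_psd : psd_form (L2c X) B.
Proof.
split=> [f g Lf Lg|a f g h Lf Lg Lh|f Lf].
- rewrite (FCCov2E f g).
  rewrite (FCCov2E g f).
  apply: (congr1 fine).
  apply: eq_integral => w _.
  apply: (congr1 EFin).
  exact: mulrC.
- have Lfg : L2c X (a *: f + g) by apply: (L2c_lin_closed X).2.
  rewrite !FCCov2E -fine_integral_lin ?c_fun_integrableM//; congr fine.
  have [mf mg mh] := And3 (L2c_c_fun_measurable Lf) (L2c_c_fun_measurable Lg)
    (L2c_c_fun_measurable Lh).
  apply: integral_ae_eq_EFin => //.
  + exact: (measurable_funM (L2c_c_fun_measurable Lfg) mh).
  + exact: (measurable_funD (measurable_funM (measurable_cst a)
      (measurable_funM mf mh)) (measurable_funM mg mh)).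
  + by apply: filterS (c_fun_lin a Lf Lg) => w e; rewrite e mulrDl mulrA.
- rewrite FCCov2E fine_ge0// integral_ge0// => w _.
  by rewrite lee_fin -expr2 sqr_ge0.
Qed.

End FCCov_form.

(** * Sufficiency *)

Section sufficiency.
Context d (T : measurableType d) (R : realType) (P : probability T R).
Context d1 d2 (T1 : measurableType d1) (T2 : measurableType d2) (M : pmetricType R).
Variables (X : {RV P >-> T1}) (Y Ybar Ytil : {RV P >-> borelType M}).
Hypotheses (sepM : separable_space M) (indep : independent_copies X Y Ybar Ytil).
Variable f0 : {mfun T1 >-> T2}.
Local Notation G0 := (g_sigma_algebra_preimage (f0 \o X)).
Hypothesis ci : cond_indep G0 X Y.

Let Z0 : {mfun T >-> T2} := [the {mfun T >-> T2} of f0 \o X].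

Let indic_le1 (A : set T) w : `|(\1_A : T -> R) w| <= 1.
Proof. by rewrite indicE; case: (_ \in _); rewrite ?normr1 ?normr0. Qed.

Let integral_bounded0 (u : T2 -> R) (c : R) V : measurable_fun [set: T2] u ->
  (forall x, `|u x| <= c) -> P.-integrable [set: T] (EFin \o V) ->
  (forall B, measurable B -> \int[P]_(w in Z0 @^-1` B) (V w)%:E = 0)%E ->
  (\int[P]_w (u (Z0 w) * V w)%:E = 0)%E.
Proof.
move=> mu uc iV; apply: integral_mul_preimage0 => //.
by apply: (integrable_bndM (c := c) _ _ iV) => [|w]; [exact: measurableT_comp|exact: uc].
Qed.

Let version_integral0 U k : P.-integrable [set: T] (EFin \o U) ->
  cond_exp_version P G0 U (k \o Z0) -> forall B, measurable B ->
  (\int[P]_(w in Z0 @^-1` B) (U w - k (Z0 w))%:E = 0)%E.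
Proof.
move=> iU [_ ik kU] B mB.
have mZB : measurable (Z0 @^-1` B) by exact: measurable_funPTI.
rewrite (integral_EFinB mZB iU ik) (kU (Z0 @^-1` B)); last first.
  by apply/(preimage_sigma_fieldP Z0); exists B.
by rewrite subee// integral_fin_numT.
Qed.

(** The other form of conditional independence: k(f0(X)), a version of P(Y in B | f0(X)), is also
    one of P(Y in B | X). Both integrals over X in A equal the expectation of P(X in A | f0(X))
    k(f0(X)). *)
Lemma cond_indep_version (B : set (borelType M)) (k : T2 -> R) :
  measurable B -> measurable_fun [set: T2] k -> (forall x, `|k x| <= 1) ->
  cond_exp_version P G0 (\1_(Y @^-1` B) : T -> R) (k \o Z0) ->
  forall A, measurable A ->
  (\int[P]_(w in X @^-1` A) (\1_(Y @^-1` B) w - k (Z0 w))%:E = 0)%E.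
Proof.
move=> mB mk k1 Pk A mA.
have mXA : measurable (X @^-1` A) by exact: measurable_funPTI.
have mYB : measurable (Y @^-1` B) by exact: measurable_funPTI.
have iXA : P.-integrable [set: T] (EFin \o (\1_(X @^-1` A) : T -> R)).
  exact: integrable_indic.
have iYB : P.-integrable [set: T] (EFin \o (\1_(Y @^-1` B) : T -> R)).
  exact: integrable_indic.
have iAB : P.-integrable [set: T] (EFin \o (\1_(X @^-1` A `&` Y @^-1` B) : T -> R)).
  by apply: integrable_indic; exact: measurableI.
have [pA [mpA pA1 PpA]] := cond_exp_factor_bounded P Z0
  (integrable_measurable_fun iXA) (indic_le1 (X @^-1` A)).
have PA : cond_exp_version P G0 (\1_(X @^-1` A) : T -> R) (cond_prob P G0 (X @^-1` A)) :=
  cond_expP Z0 iXA.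
have PB : cond_exp_version P G0 (\1_(Y @^-1` B) : T -> R) (cond_prob P G0 (Y @^-1` B)) :=
  cond_expP Z0 iYB.
have PAB : cond_exp_version P G0 (\1_(X @^-1` A `&` Y @^-1` B) : T -> R)
  (cond_prob P G0 (X @^-1` A `&` Y @^-1` B)) := cond_expP Z0 iAB.
have eA := cond_exp_version_unique (Z := Z0) (fun _ _ => erefl) PA PpA.
have eB := cond_exp_version_unique (Z := Z0) (fun _ _ => erefl) PB Pk.
have [wAB iPAB intAB] := PAB; have [_ ik _] := Pk; have [_ ipA _] := PpA.
have ipAk : P.-integrable [set: T] (EFin \o (fun w => pA (Z0 w) * k (Z0 w))).
  apply: (integrable_bndM (c := 1) _ _ ik) => [|w]; last exact: pA1.
  exact: measurableT_comp.
have iAk : P.-integrable [set: T] (EFin \o (fun w => \1_(X @^-1` A) w * k (Z0 w))).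
  exact: integrable_indicM.
have int1 : (\int[P]_w (\1_(X @^-1` A `&` Y @^-1` B) w)%:E =
    \int[P]_w (pA (Z0 w) * k (Z0 w))%:E)%E.
  rewrite -(intAB setT); last by apply/(preimage_sigma_fieldP Z0); exists setT.
  apply: integral_ae_eq_EFin => //.
  - exact: (wrt_preimage_measurable (Z := Z0)).
  - exact: integrable_measurable_fun ipAk.
  - by apply: filterS3 (ci mA mB) eA eB => w -> -> ->.
have int2 : (\int[P]_w (pA (Z0 w) * k (Z0 w))%:E =
    \int[P]_w (\1_(X @^-1` A) w * k (Z0 w))%:E)%E.
  have := integral_bounded0 mk k1 (integrable_EFinB iXA ipA) (version_integral0 iXA PpA).
  rewrite (eq_integral (fun w => (\1_(X @^-1` A) w * k (Z0 w) - pA (Z0 w) * k (Z0 w))%:E)).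
    rewrite (integral_EFinB measurableT iAk ipAk) => /eqP.
    by rewrite sube_eq ?add0e ?fin_num_adde_defl ?integral_fin_numT// => /eqP.
  by move=> w _; rewrite mulrC mulrBl.
rewrite (integral_EFinB mXA iYB ik) -[X in (X - _)%E]integral_indicM.
rewrite -[X in (_ - X)%E]integral_indicM -int2 -int1.
rewrite (eq_integral (fun w => (\1_(X @^-1` A `&` Y @^-1` B) w)%:E)).
  by rewrite subee// (integral_fin_numT measurableT iAB).
by move=> w _; rewrite indicI.
Qed.

(** Replace the indicator of Y in B by its conditional probability given X, a function of f0(X); to
    such functions h(X) is orthogonal. *)
Lemma cond_indep_residual (h : T1 -> R) : measurable_fun [set: T1] h ->
  P.-integrable [set: T] (EFin \o (h \o X)) ->
  (forall C, measurable C -> \int[P]_(w in Z0 @^-1` C) (h (X w))%:E = 0)%E ->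
  forall B : set (borelType M), measurable B ->
    (\int[P]_(w in Y @^-1` B) (h (X w))%:E = 0)%E.
Proof.
move=> mh ih h0 B mB.
have mYB : measurable (Y @^-1` B) by exact: measurable_funPTI.
have iYB : P.-integrable [set: T] (EFin \o (\1_(Y @^-1` B) : T -> R)).
  exact: integrable_indic.
have [k [mk k1 Pk]] := cond_exp_factor_bounded P Z0
  (integrable_measurable_fun iYB) (indic_le1 (Y @^-1` B)).
have [_ ik _] := Pk.
have ihB : P.-integrable [set: T] (EFin \o (fun w => \1_(Y @^-1` B) w * h (X w))).
  exact: integrable_indicM.
have ihk : P.-integrable [set: T] (EFin \o (fun w => k (Z0 w) * h (X w))).
  apply: (integrable_bndM (c := 1) _ _ ih) => [|w]; last exact: k1.
  exact: measurableT_comp.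
have E w : h (X w) * (\1_(Y @^-1` B) w - k (Z0 w)) =
    \1_(Y @^-1` B) w * h (X w) - k (Z0 w) * h (X w) by ring.
have : (\int[P]_w (h (X w) * (\1_(Y @^-1` B) w - k (Z0 w)))%:E = 0)%E.
  apply: (integral_mul_preimage0 (Z := X) mh (integrable_EFinB iYB ik)).
    rewrite (_ : EFin \o _ = EFin \o
      (fun w => \1_(Y @^-1` B) w * h (X w) - k (Z0 w) * h (X w))).
      exact: integrable_EFinB.
    by apply/funext => w /=; congr EFin; exact: E.
  exact: cond_indep_version.
under eq_integral do rewrite E.
rewrite (integral_EFinB measurableT ihB ihk) (integral_bounded0 mk k1 ih h0) sube0.
by rewrite integral_indicM.
Qed.

(** The event D intersected with an event of the copies is an event of (Y, Ybar, Ytil), over which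
    h(X) integrates to zero; hence c_h = 0. *)
Lemma FCCov2_residual (f h : T1 -> R) : L2c X f -> L2c X h ->
  (forall C, measurable C -> \int[P]_(w in Z0 @^-1` C) (h (X w))%:E = 0)%E ->
  FCCov2 X Y Ybar Ytil f h = 0.
Proof.
move=> Lf Lh h0; have /L2cP[mh _ _] := Lh; have ih := L2c_integrable Lh.
have hY := cond_indep_residual mh ih h0.
have hYZ := responses_integral0 indep mh ih hY.
have mD : measurable (dist_lt Y Ybar Ytil) := measurable_dist_lt Y Ybar Ytil sepM.
have c0 : \forall w \ae P, c_fun X Y Ybar Ytil h w = 0.
  have z : cond_exp_version P (g_sigma_algebra_preimage (fun w => (Ybar w, Ytil w)))
      (fun=> 0) (fun=> 0).
    by split=> // [B mB|]; [exact: (wrt_preimage_comp (copies Ybar Ytil) (k := fun=> 0))|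
      exact: integrable_EFin_cst].
  apply: (cond_exp_version_unique (Z := copies Ybar Ytil) _
    (L2c_c_fun_version sepM indep Lh) z) => A GA.
  rewrite integral0 -integral_indicM.
  have [C mC ->] := (preimage_sigma_fieldP (copies Ybar Ytil) A).1 GA.
  rewrite -(hYZ (closer_set (M := M) `&` (setT `*` C))); last first.
    by apply: measurableI; [exact: measurable_closer_set|exact: measurableX].
  rewrite -[RHS]integral_indicM; apply: eq_integral => w _.
  rewrite mulrA; congr ((_ * _)%:E); rewrite mulrC.
  rewrite -[LHS]/((\1_(dist_lt Y Ybar Ytil) \* \1_(copies Ybar Ytil @^-1` C)) w) -indicI.
  congr (\1_ _ w); apply/seteqP; split.
    by move=> t /= [Dt Ct]; split.
  by move=> t /= [Dt [_ Ct]]; split.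
have [mf mch] := (L2c_c_fun_measurable sepM indep Lf, L2c_c_fun_measurable sepM indep Lh).
rewrite FCCov2E (_ : (\int[P]_w _)%E = 0%E)//.
rewrite -[RHS](@integral0 _ _ _ P setT).
apply: (integral_ae_eq_EFin (V := fun=> 0)) => //.
- exact: (measurable_funM mf mch).
- by apply: filterS c0 => w e; rewrite e mulr0.
Qed.

Lemma eigenfunction_measurable (f : T1 -> R) (a : R) : L2c X f -> a != 0 ->
  (forall h, L2c X h -> FCCov2 X Y Ybar Ytil f h = a * inner_product X f h) ->
  exists2 k : T2 -> R, measurable_fun [set: T2] k &
    \forall x \ae distribution P X, f x = k (f0 x).
Proof.
move=> Lf a0 fE; have /L2cP[mf _ ef] := Lf; have intf := L2c_integrable Lf.
have [k [mk ik kf]] := cond_exp_factor Z0 intf.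
have Pk := cond_exp_factor_version mk ik kf.
exists k => //.
have mkf0 : measurable_fun [set: T1] (k \o f0) by exact: measurableT_comp.
apply: ae_eq_distribution => //.
apply: (wrt_preimage_unique_ae (wrt_preimage_comp X mf) (wrt_preimage_comp X mkf0) intf ik).
move=> _ /(preimage_sigma_fieldP X)[A mA ->].
have mXA : measurable (X @^-1` A) by exact: measurable_funPTI.
have iXA : P.-integrable [set: T] (EFin \o (\1_(X @^-1` A) : T -> R)).
  exact: integrable_indic.
have [q [mq q1 Pq]] := cond_exp_factor_bounded P Z0
  (integrable_measurable_fun iXA) (indic_le1 (X @^-1` A)).
have [_ iq qA] := Pq.
(* The test function is the residual of an indicator, not of [f]: it is bounded, so it lies in L2 at
   once, without an L2 bound on the conditional expectation of f(X). *)
pose h x : R := \1_A x - q (f0 x).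
have mh : measurable_fun [set: T1] h.
  by apply: measurable_funB; [exact: measurable_indic|exact: measurableT_comp].
have ih : P.-integrable [set: T] (EFin \o (h \o X)) := integrable_EFinB iXA iq.
have h0 := version_integral0 iXA Pq.
have h2 x : `|h x| <= 2.
  rewrite (le_trans (ler_normB _ _))// (_ : 2 = 1 + 1 :> R)// lerD ?q1//.
  by rewrite indicE; case: (_ \in _); rewrite ?normr1 ?normr0.
have Lh : L2c X h.
  apply/L2cP; split => //; last exact: (h0 setT measurableT).
  rewrite (_ : EFin \o _ = EFin \o (fun w => h (X w) * h (X w))).
    by apply: (integrable_bndM (c := 2) _ _ ih) => [|w]; [exact: measurableT_comp|exact: h2].
  by apply/funext => w /=; rewrite expr2.
have : inner_product X f h = 0.
  by apply: (mulfI a0); rewrite mulr0 -fE// FCCov2_residual.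
rewrite inner_productE// => fh.
have ifA : P.-integrable [set: T] (EFin \o (fun w => \1_(X @^-1` A) w * f (X w))).
  exact: integrable_indicM.
have ifq : P.-integrable [set: T] (EFin \o (fun w => q (Z0 w) * f (X w))).
  by apply: (integrable_bndM (c := 1) _ _ intf) => [|w]; [exact: measurableT_comp|exact: q1].
have ikq : P.-integrable [set: T] (EFin \o (fun w => q (Z0 w) * k (Z0 w))).
  by apply: (integrable_bndM (c := 1) _ _ ik) => [|w]; [exact: measurableT_comp|exact: q1].
have ikA : P.-integrable [set: T] (EFin \o (fun w => \1_(X @^-1` A) w * k (Z0 w))).
  exact: integrable_indicM.
have ifh := L2c_integrableM Lf Lh.
have e1 : (\int[P]_w (\1_(X @^-1` A) w * f (X w))%:E =
    \int[P]_w (q (Z0 w) * f (X w))%:E)%E.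
  have : (\int[P]_w (f (X w) * h (X w))%:E = 0)%E.
    by rewrite -(fineK (integral_fin_numT measurableT ifh)) fh.
  rewrite (eq_integral (fun w => (\1_(X @^-1` A) w * f (X w) - q (Z0 w) * f (X w))%:E)).
    rewrite (integral_EFinB measurableT ifA ifq) => /eqP.
    by rewrite sube_eq ?add0e ?fin_num_adde_defl ?integral_fin_numT// => /eqP.
  by move=> w _; rewrite mulrC mulrBl.
have e2 : (\int[P]_w (q (Z0 w) * f (X w))%:E = \int[P]_w (q (Z0 w) * k (Z0 w))%:E)%E.
  have := integral_bounded0 mq q1 (integrable_EFinB intf ik) (version_integral0 intf Pk).
  rewrite (eq_integral (fun w => (q (Z0 w) * f (X w) - q (Z0 w) * k (Z0 w))%:E)).
    rewrite (integral_EFinB measurableT ifq ikq) => /eqP.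
    by rewrite sube_eq ?add0e ?fin_num_adde_defl ?integral_fin_numT// => /eqP.
  by move=> w _; rewrite mulrBr.
have e3 : (\int[P]_w (\1_(X @^-1` A) w * k (Z0 w))%:E =
    \int[P]_w (q (Z0 w) * k (Z0 w))%:E)%E.
  have E w : k (Z0 w) * (\1_(X @^-1` A) w - q (Z0 w)) =
    \1_(X @^-1` A) w * k (Z0 w) - q (Z0 w) * k (Z0 w) by ring.
  have : (\int[P]_w (k (Z0 w) * (\1_(X @^-1` A) w - q (Z0 w)))%:E = 0)%E.
    apply: integral_mul_preimage0 => //.
    rewrite (_ : EFin \o _ = EFin \o
      (fun w => \1_(X @^-1` A) w * k (Z0 w) - q (Z0 w) * k (Z0 w))).
      exact: integrable_EFinB.
    by apply/funext => w /=; congr EFin; exact: E.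
  under eq_integral do rewrite E.
  rewrite (integral_EFinB measurableT ikA ikq) => /eqP.
  by rewrite sube_eq ?add0e ?fin_num_adde_defl ?integral_fin_numT// => /eqP.
by rewrite -integral_indicM e1 e2 -e3 integral_indicM.
Qed.

End sufficiency.

(** * Penalized minimizers *)

Lemma frobenius_norm_sqr (R : realType) m n (A : 'M[R]_(m, n)) :
  frobenius_norm A ^+ 2 = \sum_i \sum_j A i j ^+ 2.
Proof.
rewrite sqr_sqrtr// sumr_ge0// => i _; rewrite sumr_ge0// => j _; exact: sqr_ge0.
Qed.

Lemma psd_sqrt_diag_mx (R : realType) n (s : 'rV[R]_n) :
  (forall i, 0 <= s 0 i) ->
  psd_sqrt_mx (diag_mx s) (diag_mx (\row_i Num.sqrt (s 0 i))).
Proof.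
move=> s0; split; first exact: tr_diag_mx.
- move=> v; rewrite -mulmxA mul_diag_mx !mxE sumr_ge0// => i _.
  by rewrite !mxE mulrCA mulr_ge0 ?sqrtr_ge0// -expr2 sqr_ge0.
- rewrite mul_diag_mx; apply/matrixP => i j; rewrite !mxE.
  by case: eqP => [->|]; rewrite ?mulr0n ?mulr0// !mulr1n -expr2 sqr_sqrtr.
Qed.

Section penalized_solution.
Context d (T : measurableType d) (R : realType) (P : probability T R).
Context d1 (T1 : measurableType d1) (M : pmetricType R).
Variables (X : {RV P >-> T1}) (Y Ybar Ytil : {RV P >-> borelType M}).
Hypotheses (sepM : separable_space M) (indep : independent_copies X Y Ybar Ytil).
Variables (n : nat) (f : 'I_n.+1 -> T1 -> R) (l : 'I_n.+1 -> R).
Hypothesis fsol : normalized_solution X Y Ybar Ytil f l.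
Hypothesis lgap : forall i j : 'I_n.+1, (i < j)%N -> l i < l j.

Local Notation B := (FCCov2 X Y Ybar Ytil).
Local Notation ip := (inner_product X).
Local Notation emb := (widen_ord (leqnSn n)).

Let DL := L2c_lin_closed X.
Let ipP := inner_product_psd X.
Let bP := FCCov2_psd sepM indep.

Let Lf i : L2c X (f i). Proof. by case: fsol => -[]. Qed.

Lemma var_mx_orthonormal m (g : 'I_m -> T1 -> R) :
  var_mx X g = 1%:M <-> orthonormal_family ip g.
Proof.
split=> [/matrixP g1 i j|g1]; first by rewrite -var_mxE g1 mxE.
by apply/matrixP => i j; rewrite var_mxE g1 mxE.
Qed.

Let f1 : orthonormal_family ip f.
Proof. by case: fsol => -[_ /var_mx_orthonormal]. Qed.

Let fmax (g : 'I_n.+1 -> T1 -> R) : (forall i, L2c X (g i)) -> orthonormal_family ip g ->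
  \sum_i B (g i) (g i) <= \sum_i B (f i) (f i).
Proof.
case: fsol => -[_ _ fM] _ _ Lg /var_mx_orthonormal g1; exact: (fM g Lg g1).
Qed.

Let lE i : B (f i) (f i) = - l i.
Proof. by case: fsol => _ /(_ i i) + _; rewrite eqxx => <-; rewrite opprK. Qed.

Let fdiag i j : i != j -> B (f i) (f j) = 0.
Proof.
move=> ij; case: fsol => _ /(_ i j) + _; rewrite (negbTE ij) => /eqP.
by rewrite oppr_eq0 => /eqP.
Qed.

Let gap (i j : 'I_n.+1) : (i < j)%N -> B (f j) (f j) < B (f i) (f i).
Proof. by move=> ij; rewrite !lE ltrN2 lgap. Qed.

Lemma normalized_solution_eigen i h : L2c X h ->
  B (f i) h = - l i * ip (f i) h.
Proof.
by move=> Lh; rewrite (maximal_frame_eigen DL ipP bP Lf f1 fmax fdiag i Lh) lE.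
Qed.

(** The eigenvalue -l of the last function is nonnegative, and the gap puts the others strictly
    above it. This allows division by the eigenvalue in part (b). *)
Lemma normalized_solution_lt0 i : l (emb i) < 0.
Proof.
have : B (f ord_max) (f ord_max) < B (f (emb i)) (f (emb i)).
  by apply: gap; rewrite /= ltn_ord.
have : 0 <= B (f ord_max) (f ord_max) by case: bP => _ _; apply.
by rewrite [B (f (emb i)) _]lE => h1 h2; rewrite -oppr_gt0; exact: le_lt_trans h2.
Qed.

Lemma penalized_lossE lambda m (u : 'I_m -> T1 -> R) :
  penalized_loss X Y Ybar Ytil lambda u = form_loss ip B lambda u.
Proof.
rewrite /penalized_loss /form_loss frobenius_norm_sqr; congr (- _ + _ * _).
by apply: eq_bigr => i _; apply: eq_bigr => j _; rewrite !mxE.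
Qed.

Variables (lambda : R) (u : 'I_n -> T1 -> R).
Hypotheses (lambda0 : 0 < lambda)
  (umin : penalized_minimizer X Y Ybar Ytil lambda u).

Let L := diag_mx (\row_(i < n) l (emb i)).

Lemma penalized_minimizer_form : exists V S : 'M[R]_n,
  [/\ orthogonal_mx V, psd_sqrt_mx (1%:M - (2 * lambda)^-1 *: L) S &
    \forall x \ae distribution P X,
      \col_j u j x = V *m S *m \col_j f (emb j) x].
Proof.
have [Lu umin'] := umin.
have umin2 (w : 'I_n -> T1 -> R) : (forall t, L2c X (w t)) ->
    form_loss ip B lambda u <= form_loss ip B lambda w.
  by move=> Lw; rewrite -!penalized_lossE; exact: umin'.
have [V [VV Vw]] := penalized_minimizer_structure DL ipP bP lambda0 Lf f1 fmax fdiag gap Lu umin2.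
exists V, (diag_mx (\row_i Num.sqrt (1 + B (f (emb i)) (f (emb i)) / (2 * lambda)))).
split => //.
- pose s := \row_(i < n) (1 + B (f (emb i)) (f (emb i)) / (2 * lambda)) : 'rV[R]_n.
  have -> : 1%:M - (2 * lambda)^-1 *: L = diag_mx s.
    apply/matrixP => i j; rewrite !mxE lE.
    by case: eqP => _; rewrite ?mulr1n ?mulr0n; ring.
  rewrite (_ : (\row_i _) = \row_i Num.sqrt (s 0 i)).
    apply: psd_sqrt_diag_mx => i; rewrite mxE addr_ge0// divr_ge0//; last by rewrite mulr_ge0// ltW.
    by case: bP => _ _; apply.
  by apply/rowP => i; rewrite !mxE.
- set S := diag_mx _ in Vw *.
  (* Null vectors of the covariance form are almost surely zero functions; there are finitely many
     components, so one null set serves all of them. *)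
  have : \forall x \ae distribution P X, forall t : 'I_n,
      u t x - (\sum_i (V *m S) t i *: f (emb i)) x = 0.
    apply: filter_forall => t; apply: inner_product_null; last exact: Vw.
    apply: (lin_closedB DL); first exact: Lu.
    by apply: (lin_closed_sum DL) => i; exact: Lf.
  apply: filterS => x ux; apply/colP => t; rewrite mxE.
  move/eqP: (ux t); rewrite subr_eq0 => /eqP ->.
  rewrite fct_sumE mxE; apply: eq_bigr => i _.
  by rewrite [X in _ = _ * X]mxE.
Qed.

Lemma penalized_minimizer_measurable d2 (T2 : measurableType d2)
    (f0 : {mfun T1 >-> T2}) j :
  cond_indep (g_sigma_algebra_preimage (f0 \o X)) X Y ->
  L2_measurable_wrt X (g_sigma_algebra_preimage (f0 \o X)) (u j).
Proof.
move=> ci; have [V [S [_ _ uVS]]] := penalized_minimizer_form.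
have Lfu : u j \in Lfun (distribution P X) 2%:E by have [/(_ j)[]] := umin.
have /choice[k kP] : forall i : 'I_n, exists k : T2 -> R,
    measurable_fun [set: T2] k /\
    (\forall x \ae distribution P X, f (emb i) x = k (f0 x)).
  move=> i; have a0 : - l (emb i) != 0.
    by rewrite oppr_eq0 lt_eqF// normalized_solution_lt0.
  have [k mk fk] := eigenfunction_measurable sepM indep ci (Lf (emb i)) a0
    (@normalized_solution_eigen (emb i)).
  by exists k.
pose g (z : T2) := \sum_i (V *m S) j i * k i z.
have mg : measurable_fun [set: T2] g.
  apply: measurable_sum => i; apply: measurable_funM => //.
  by have [] := kP i.
have ug : \forall x \ae distribution P X, u j x = g (f0 x).
  have kf : \forall x \ae distribution P X, forall i : 'I_n, f (emb i) x = k i (f0 x).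
    by apply: filter_forall => i; have [] := kP i.
  apply: filterS2 uVS kf => x /colP/(_ j) + kx; rewrite !mxE => ->.
  by apply: eq_bigr => i _; rewrite [X in _ * X]mxE kx.
have mgf0 : measurable_fun [set: T1] (g \o f0) by exact: measurableT_comp.
split => //; exists (g \o f0); split => //; last first.
  exact: (wrt_preimage_comp [the {mfun T >-> T2} of f0 \o X] mg).
have [mu u2] := (Lfun2P _ _).1 Lfu.
(* The representative [g \o f0] gets its square integrability from [u j], with which it agrees
   almost surely. *)
apply/Lfun2P; split => //; apply: (integrable_ae_eq _ u2).
  exact: measurable_funX.
by apply: filterS ug => x ->.
Qed.

End penalized_solution.

Theorem theorem4p3 (R : realType) (disp : measure_display)
    (T : measurableType disp) (P : probability T R) (p d : nat)
    (M : pmetricType R)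
    (OmegaX : set (p.-tuple R))
    (X : {RV P >-> p.-tuple R})
    (Y Ybar Ytil : {RV P >-> borelType M})
    (f0 : {mfun p.-tuple R >-> d.-tuple R})
    (fstar : 'I_d.+1 -> p.-tuple R -> R) (l : 'I_d.+1 -> R)
    (lambda : R) (flam : 'I_d -> p.-tuple R -> R) :
  (forall w, OmegaX (X w)) ->
  separable_space M ->
  dominated_cond_distribution X Y ->
  independent_copies X Y Ybar Ytil ->
  ('E_P[fun w => (mdist (Y w : M) (Ytil w) ^+ 2)%R] < +oo)%E ->
  (d < p)%N ->
  (forall i, L2c X (fun x => tnth (f0 x) i)) ->
  var_mx X (fun i x => tnth (f0 x) i) = 1%:M ->
  central_sigma_field X Y (g_sigma_algebra_preimage (f0 \o X)) ->
  normalized_solution X Y Ybar Ytil fstar l ->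
  (forall i j : 'I_d.+1, (i < j)%N ->
     [/\ l i = - FCCov X Y Ybar Ytil (fstar i),
         - FCCov X Y Ybar Ytil (fstar i) < - FCCov X Y Ybar Ytil (fstar j) &
         - FCCov X Y Ybar Ytil (fstar j) = l j]) ->
  0 < lambda ->
  penalized_minimizer X Y Ybar Ytil lambda flam ->
  (let L := diag_mx (\row_(i < d) l (widen_ord (leqnSn d) i)) in
   exists V S : 'M[R]_d,
     [/\ orthogonal_mx V,
         psd_sqrt_mx (1%:M - (2 * lambda)^-1 *: L) S &
         \forall x \ae distribution P X,
           \col_j flam j x =
           V *m S *m \col_j fstar (widen_ord (leqnSn d) j) x]) /\
  (forall j, L2_measurable_wrt X (g_sigma_algebra_preimage (f0 \o X)) (flam j)).
Proof.
move=> _ sepM _ indep _ _ _ _ [_ ci _] fsol gap lambda0 umin.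
have lgap (i j : 'I_d.+1) : (i < j)%N -> l i < l j.
  by move=> /gap[-> lt_ij <-].
split; first exact: penalized_minimizer_form fsol lgap _ _ lambda0 umin.
by move=> j; apply: penalized_minimizer_measurable fsol lgap _ _ lambda0 umin _ _ _ j ci.
Qed.
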